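(* Let $(Z,\alpha)$ be an antipodal space. Then $(Z,\alpha)$ is quasi-metric if and only if the Moebius space $\mathcal{M}(Z)$ is Gromov hyperbolic. In this case, $\mathcal{M}(Z)$ is a boundary continuous Gromov hyperbolic space, and there is a Moebius homeomorphism $f:\partial\mathcal{M}(Z)\to Z$ from its visual boundary to $Z$ (so that $\mathcal{M}(Z)$ with $f$ is a Moebius hyperbolic filling of $Z$) such that, for the basepoint $\alpha\in\mathcal{M}(Z)$, $f:(\partial\mathcal{M}(Z),\rho_\alpha)\to(Z,\alpha)$ is an isometry of quasi-metric spaces, i.e. $\alpha(f(\xi),f(\eta))=\rho_\alpha(\xi,\eta)$ for all $\xi,\eta\in\partial\mathcal{M}(Z)$.
   Context: Antipodal spaces and Moebius spaces. Let $Z$ be a compact metrizable space containing at least four points. A separating function on $Z$ is a continuous function $\rho : Z\times Z\to[0,\infty)$ which is symmetric and satisfies $\rho(\xi,\eta)=0$ if and only if $\xi=\eta$. Its cross-ratio is defined on quadruples of distinct points of $Z$ by $[\xi,\xi',\eta,\eta']_\rho=\frac{\rho(\xi,\eta)\rho(\xi',\eta')}{\rho(\xi,\eta')\rho(\xi',\eta)}$. Two separating functions are Moebius equivalent if their cross-ratios agree. If $\rho_1,\rho_2$ are Moebius equivalent, there is a unique positive continuous function $\frac{d\rho_2}{d\rho_1}:Z\to(0,\infty)$, the derivative, such that $\rho_2(\xi,\eta)^2=\frac{d\rho_2}{d\rho_1}(\xi)\frac{d\rho_2}{d\rho_1}(\eta)\rho_1(\xi,\eta)^2$ for all $\xi,\eta\in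 Z$. An antipodal function on $Z$ is a separating function $\rho$ such that $\sup_{\xi,\eta}\rho(\xi,\eta)=1$ and for every $\xi\in Z$ there is $\eta\in Z$ with $\rho(\xi,\eta)=1$. An antipodal space $(Z,\alpha)$ is such a space $Z$ equipped with an antipodal function $\alpha$. Its Moebius space $\mathcal{M}(Z)=\mathcal{M}(Z,\alpha)$ is the set of all antipodal functions on $Z$ Moebius equivalent to $\alpha$, with the metric $d_{\mathcal{M}}(\rho_1,\rho_2)=\left\|\log\frac{d\rho_2}{d\rho_1}\right\|_\infty$; note $\alpha\in\mathcal{M}(Z)$. A map between sets carrying cross-ratios is Moebius if it preserves cross-ratios of all quadruples of distinct points. The antipodal space $(Z,\alpha)$ is quasi-metric if $\alpha$ is a quasi-metric: for some $K\ge1$, $\alpha(\xi,\eta)\le K\max(\alpha(\xi,\zeta),\alpha(\zeta,\eta))$ for all $\xi,\eta,\zeta\in Z$. For a metric space $X$, $(y|z)_x=\frac12(d(x,y)+d(x,z)-d(y,z))$ is the Gromov product. $X$ is Gromov hyperbolic if for some $\delta\ge0$, $(a|b)_x\ge\min((a|c)_x,(c|b)_x)-\delta$ for all $a,b,c,x\in X$. For a proper geodesic Gromov hyperbolic space $X$, $\partial X$ is its visual (Gromov) boundary and $\overline X=X\cup\partial X$ its visual (Gromov) compactification. $X$ is boundary continuous if for each $x\in X$ the Gromov product $(\cdot|\cdot)_x$ extends to a continuous function $\overline X\times\overline X\to[0,+\infty]$; then one sets $\rho_x(\xi,\eta)=e^{-(\xi|\eta)_x}$ for $\xi,\eta\in\partial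 X$ (visual quasi-metric). The cross-ratios of the $\rho_x$ do not depend on $x$, and $\partial X$ is given this cross-ratio. A Moebius hyperbolic filling of $Z$ is a boundary continuous Gromov hyperbolic space $X$ together with a Moebius homeomorphism $\partial X\to Z$. *)

(* Defs.v *)
From HB Require Import structures.
From mathcomp Require Import all_boot all_order all_algebra.
From mathcomp Require Import all_classical all_reals all_analysis.
From mathcomp Require Import ring.
Set Implicit Arguments.
Unset Strict Implicit.
Unset Printing Implicit Defensive.
Import Order.TTheory GRing.Theory Num.Theory.
Import numFieldNormedType.Exports.
Local Open Scope classical_set_scope.
Local Open Scope ring_scope.

Section separating_functions.
Context {R : realType} {Z : topologicalType}.
Implicit Types rho : Z -> Z -> R.

Definition metrizable : Prop :=
  exists d : Z -> Z -> R,
    [/\ forall x y, 0 <= d x y,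
        forall x y, d x y = 0 <-> x = y,
        forall x y, d x y = d y x,
        forall y x z, d x z <= d x y + d y z
      & forall x, nbhs x =
          filter_from [set e : R | 0 < e] (fun e => [set y | d x y < e])].

Definition separating rho : Prop :=
  [/\ continuous (fun p : Z * Z => rho p.1 p.2),
      forall x y, 0 <= rho x y,
      forall x y, rho x y = rho y x
    & forall x y, rho x y = 0 <-> x = y].

Definition antipodal rho : Prop :=
  [/\ separating rho,
      sup (range (fun p : Z * Z => rho p.1 p.2)) = 1
    & forall x, exists y, rho x y = 1].

Definition quasi_metric rho : Prop :=
  exists2 K : R, 1 <= K &
    forall x y z, rho x y <= K * Num.max (rho x z) (rho z y).

Definition moebius_derivative_of rho1 rho2 (l : Z -> R) : Prop :=
  [/\ continuous l, forall x, 0 < l x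
    & forall x y, rho2 x y ^+ 2 = l x * l y * rho1 x y ^+ 2].

Definition moebius_derivative rho1 rho2 : Z -> R :=
  xget (fun=> 1) [set l | moebius_derivative_of rho1 rho2 l].

End separating_functions.

Arguments metrizable R Z : clear implicits.

Definition cross_ratio (R : realType) (T : Type) (rho : T -> T -> R)
    (x x' y y' : T) : R :=
  rho x y * rho x' y' / (rho x y' * rho x' y).

Definition moebius_map (R : realType) (S T : choiceType) (rhoS : S -> S -> R)
    (rhoT : T -> T -> R) (f : S -> T) : Prop :=
  forall x x' y y', uniq [:: x; x'; y; y'] ->
    cross_ratio rhoT (f x) (f x') (f y) (f y') = cross_ratio rhoS x x' y y'.

Definition moebius_equiv (R : realType) (T : choiceType)
    (rho1 rho2 : T -> T -> R) : Prop :=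
  forall x x' y y', uniq [:: x; x'; y; y'] ->
    cross_ratio rho1 x x' y y' = cross_ratio rho2 x x' y y'.

Definition four_points (T : choiceType) : Prop :=
  exists a b c d : T, uniq [:: a; b; c; d].

Record antipodalSpace (R : realType) := AntipodalSpace {
  antipodal_carrier :> topologicalType;
  antipodal_fun : antipodal_carrier -> antipodal_carrier -> R;
  antipodal_compact : compact [set: antipodal_carrier];
  antipodal_metrizable : metrizable R antipodal_carrier;
  antipodal_four_points : four_points antipodal_carrier;
  antipodal_funP : antipodal antipodal_fun }.

Section derivative_theory.
Context {R : realType} {Z : topologicalType}.
Implicit Types (rho : Z -> Z -> R) (l : Z -> R).
Hypothesis Z4 : four_points Z.

Lemma pick_third (x y : Z) : exists z, z != x /\ z != y.
Proof.
have [a [b [c [d]]]] := Z4; rewrite /= !inE !negb_or.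
move=> /and4P[/and3P[ab ac _] /andP[bc _] _ _].
have [ax|ax] := eqVneq a x.
  have [bY|bY] := eqVneq b y.
    by exists c; rewrite -ax -bY ![c == _]eq_sym.
  by exists b; rewrite -ax [b == a]eq_sym.
have [aY|aY] := eqVneq a y; last by exists a.
have [bx|bx] := eqVneq b x.
  by exists c; rewrite -aY -bx ![c == _]eq_sym.
by exists b; rewrite -aY [b == a]eq_sym.
Qed.

Lemma separating_gt0 rho x y : separating rho -> (0 < rho x y) = (x != y).
Proof.
case=> _ r0 _ rE; rewrite lt_neqAle r0 andbT eq_sym.
by congr (~~ _); apply/eqP/eqP => /rE.
Qed.

Lemma separating_neq0 rho x y : separating rho -> x != y -> rho x y != 0.
Proof. by move=> sr; rewrite -(separating_gt0 x y sr) => /lt0r_neq0. Qed.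

Lemma separating_continuousl rho y :
  separating rho -> continuous (fun x => rho x y).
Proof.
case=> cr _ _ _ x.
apply: (@cvg_comp _ _ _ (fun x => (x, y)) (fun p => rho p.1 p.2) _
  (nbhs (x, y)) _ _ (cr (x, y))).
by apply: cvg_pair => //=; exact: cvg_cst.
Qed.

(* The value of the derivative at [x], computed from any two further points. *)
Definition derivative3 rho1 rho2 (x y z : Z) : R :=
  rho2 x y * rho2 x z * rho1 y z / (rho1 x y * rho1 x z * rho2 y z).

Lemma moebius_derivative_of3 rho1 rho2 l x y z :
  separating rho1 -> separating rho2 -> moebius_derivative_of rho1 rho2 l ->
  x != y -> x != z -> y != z -> l x = derivative3 rho1 rho2 x y z.
Proof.
move=> s1 s2 [_ l0 lE] xy xz yz; have [[lx ly] lz] := (l0 x, l0 y, l0 z).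
have p (r : Z -> Z -> R) a b (sr : separating r) : a != b -> 0 < r a b.
  by rewrite (separating_gt0 _ _ sr).
move: (p _ _ _ s1 xy) (p _ _ _ s1 xz) (p _ _ _ s1 yz).
move: (p _ _ _ s2 xy) (p _ _ _ s2 xz) (p _ _ _ s2 yz).
move: (lE x y) (lE x z) (lE y z); rewrite /derivative3.
set a := rho2 x y; set b := rho2 x z; set c := rho2 y z.
set a' := rho1 x y; set b' := rho1 x z; set c' := rho1 y z.
move=> Ea Eb Ec a0 b0 c0 a'0 b'0 c'0.
apply/eqP; rewrite -(@eqrXn2 _ 2) ?(ltW lx)//; last first.
  by rewrite divr_ge0 ?mulr_ge0 ?ltW.
rewrite expr_div_n !exprMn Ea Eb Ec; apply/eqP; field.
by rewrite !lt0r_neq0.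
Qed.

Lemma derivative3_sym rho1 rho2 x y z :
  separating rho1 -> separating rho2 ->
  derivative3 rho1 rho2 x y z = derivative3 rho1 rho2 x z y.
Proof.
move=> [_ _ s1 _] [_ _ s2 _]; rewrite /derivative3 (s1 y z) (s2 y z).
by congr (_ * _ / (_ * _)); rewrite mulrC.
Qed.

Lemma derivative3_swap rho1 rho2 x y z w :
  separating rho1 -> separating rho2 -> moebius_equiv rho1 rho2 ->
  x != y -> x != z -> x != w -> y != z -> y != w ->
  derivative3 rho1 rho2 x y z = derivative3 rho1 rho2 x y w.
Proof.
move=> s1 s2 m xy xz xw yz yw; have [->//|zw] := eqVneq z w.
have := m x y z w; rewrite /= !inE !negb_or xy xz xw yz yw zw => /(_ isT).
have n (r : Z -> Z -> R) a b (sr : separating r) : a != b -> r a b != 0.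
  exact: separating_neq0.
rewrite /cross_ratio /derivative3 => /eqP.
rewrite eqr_div ?mulf_neq0 ?n// => /eqP E.
apply/eqP; rewrite eqr_div ?mulf_neq0 ?n//; apply/eqP.
transitivity (rho2 x y * rho1 x y * (rho2 x z * rho2 y w
  * (rho1 x w * rho1 y z))); first by ring.
by rewrite -E; ring.
Qed.

Lemma derivative3_indep rho1 rho2 x y z y' z' :
  separating rho1 -> separating rho2 -> moebius_equiv rho1 rho2 ->
  x != y -> x != z -> y != z -> x != y' -> x != z' -> y' != z' ->
  derivative3 rho1 rho2 x y z = derivative3 rho1 rho2 x y' z'.
Proof.
move=> s1 s2 m xy xz yz xy' xz' yz'.
have [yy'|yy'] := eqVneq y y'.
  by rewrite -yy' in yz' *; exact: derivative3_swap.
rewrite (@derivative3_swap _ _ x y z y')// derivative3_sym//.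
by apply: derivative3_swap => //; rewrite eq_sym.
Qed.

Lemma moebius_derivative_exists rho1 rho2 :
  separating rho1 -> separating rho2 -> moebius_equiv rho1 rho2 ->
  exists l, moebius_derivative_of rho1 rho2 l.
Proof.
move=> s1 s2 m.
have n (r : Z -> Z -> R) a b (sr : separating r) : a != b -> r a b != 0.
  exact: separating_neq0.
have ex x : exists yz : Z * Z, [/\ x != yz.1, x != yz.2 & yz.1 != yz.2].
  have [y [yx _]] := pick_third x x; have [z [zx zy]] := pick_third x y.
  by exists (y, z); split; rewrite /= eq_sym.
pose l x := let yz := sval (cid (ex x)) in derivative3 rho1 rho2 x yz.1 yz.2.
have lE x y z : x != y -> x != z -> y != z -> l x = derivative3 rho1 rho2 x y z.
  rewrite /l; case: cid => -[y' z'] /= [xy' xz' yz'] xy xz yz.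
  exact: derivative3_indep.
exists l; split.
- move=> x; have [y [yx _]] := pick_third x x.
  have [z [zx zy]] := pick_third x y.
  rewrite eq_sym in yx; rewrite eq_sym in zx; rewrite eq_sym in zy.
  have c1 a : continuous (fun t => rho1 t a) by exact: separating_continuousl.
  have c2 a : continuous (fun t => rho2 t a) by exact: separating_continuousl.
  have near_neq a : x != a -> \forall t \near x, t != a.
    move=> xa; have /= := c1 a x; rewrite /continuous_at => cx.
    near=> t; have : rho1 t a != 0.
      by near: t; exact: cvgr_neq0 cx (n _ _ _ s1 xa).
    apply: contra => /eqP ->; apply/eqP.
    by have [_ _ _ E] := s1; exact/E.
  have E : \forall t \near x, derivative3 rho1 rho2 t y z = l t.
    by near=> t; rewrite (lE t y z)//; near: t; exact: near_neq.
  rewrite /continuous_at (lE x y z)//.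
  apply: cvg_trans (near_eq_cvg E) _.
  rewrite /derivative3; apply: cvgM.
    by apply: cvgM; [apply: cvgM; exact: c2|exact: cvg_cst].
  apply: cvgV; first by rewrite !mulf_neq0// n.
  by apply: cvgM; [apply: cvgM; exact: c1|exact: cvg_cst].
- move=> x; rewrite /l; case: cid => -[y z] /= [xy xz yz].
  by rewrite divr_gt0 ?mulr_gt0// separating_gt0.
- move=> x y; have [<-|xy] := eqVneq x y.
    have z (r : Z -> Z -> R) : separating r -> r x x = 0.
      by case=> _ _ _ E; exact/E.
    by rewrite !z// expr0n mulr0.
  have [z [zx zy]] := pick_third x y.
  rewrite eq_sym in zx; rewrite eq_sym in zy.
  rewrite (lE x y z)// (lE y x z)//; last by rewrite eq_sym.
  have [[_ _ y1 _] [_ _ y2 _]] := (s1, s2).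
  rewrite /derivative3 (y1 y x) (y2 y x); field.
  by rewrite !n.
Unshelve. all: by end_near. Qed.

Lemma moebius_derivative_unique rho1 rho2 l l' :
  separating rho1 -> separating rho2 ->
  moebius_derivative_of rho1 rho2 l -> moebius_derivative_of rho1 rho2 l' ->
  l = l'.
Proof.
move=> s1 s2 d d'; apply/funext => x.
have [y [yx _]] := pick_third x x; have [z [zx zy]] := pick_third x y.
rewrite eq_sym in yx; rewrite eq_sym in zx; rewrite eq_sym in zy.
by rewrite (moebius_derivative_of3 s1 s2 d yx zx zy)
           (moebius_derivative_of3 s1 s2 d' yx zx zy).
Qed.

Lemma moebius_derivativeP rho1 rho2 :
  separating rho1 -> separating rho2 -> moebius_equiv rho1 rho2 ->
  moebius_derivative_of rho1 rho2 (moebius_derivative rho1 rho2).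
Proof.
by move=> s1 s2 m; apply: xgetPex; exact: moebius_derivative_exists.
Qed.

Lemma moebius_derivativeE rho1 rho2 l :
  separating rho1 -> separating rho2 -> moebius_equiv rho1 rho2 ->
  moebius_derivative_of rho1 rho2 l -> moebius_derivative rho1 rho2 = l.
Proof.
by move=> s1 s2 m; apply: moebius_derivative_unique => //;
  exact: moebius_derivativeP.
Qed.

End derivative_theory.

Record moebius_space (R : realType) (Z : antipodalSpace R) := MoebiusSpace {
  moebius_fun :> Z -> Z -> R;
  moebius_fun_antipodal : antipodal moebius_fun;
  moebius_fun_equiv : moebius_equiv moebius_fun (@antipodal_fun R Z) }.

Section moebius_metric.
Context {R : realType} {Z : antipodalSpace R}.
Local Notation M := (moebius_space Z).
Implicit Types rho : M.

HB.instance Definition _ := gen_eqMixin M.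
HB.instance Definition _ := gen_choiceMixin M.

Definition moebius_basepoint : M :=
  @MoebiusSpace R Z (@antipodal_fun R Z) (antipodal_funP Z)
    (fun _ _ _ _ _ => erefl).

(* The supremum norm of [log (d rho2 / d rho1)]; the function is bounded as
   [Z] is compact. *)
Definition moebius_dist rho1 rho2 : R :=
  sup (range (fun x => `|ln (moebius_derivative rho1 rho2 x)|)).

Let Z4 := antipodal_four_points Z.

Let sepM rho : separating rho.
Proof. by case: (moebius_fun_antipodal rho). Qed.

Let equivM rho1 rho2 : moebius_equiv rho1 rho2.
Proof. by move=> x x' y y' u; rewrite !moebius_fun_equiv. Qed.

Let derP rho1 rho2 :
  moebius_derivative_of rho1 rho2 (moebius_derivative rho1 rho2).
Proof. exact: moebius_derivativeP. Qed.

Let derE rho1 rho2 l :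
  moebius_derivative_of rho1 rho2 l -> moebius_derivative rho1 rho2 = l.
Proof. exact: moebius_derivativeE. Qed.

Let eqM rho1 rho2 : (forall x y, rho1 x y = rho2 x y) -> rho1 = rho2.
Proof.
case: rho1 rho2 => [r1 a1 e1] [r2 a2 e2] /= E.
have {}E : r1 = r2 by apply/funext => x; apply/funext => y.
by rewrite E in a1 e1 *; rewrite (Prop_irrelevance a1 a2)
  (Prop_irrelevance e1 e2).
Qed.

Let has_supM rho1 rho2 :
  has_sup (range (fun x => `|ln (moebius_derivative rho1 rho2 x)|)).
Proof.
have [a _] := Z4; split.
  by exists `|ln (moebius_derivative rho1 rho2 a)|, a.
have [c d0 _] := derP rho1 rho2.
have cn : continuous (fun x => `|ln (moebius_derivative rho1 rho2 x)|).
  move=> x; apply: cvg_norm.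
  exact: (continuous_comp (c x) (continuous_ln _)).
have Z0 : [set: Z] !=set0 by exists a.
have [x _ mx] :=
  compact_EVT_max Z0 (@antipodal_compact R Z) (continuous_subspaceT cn).
exists `|ln (moebius_derivative rho1 rho2 x)| => _ [y _ <-].
by apply: mx; rewrite in_setT.
Qed.

Let dist_ub rho1 rho2 x :
  `|ln (moebius_derivative rho1 rho2 x)| <= moebius_dist rho1 rho2.
Proof. by apply: sup_upper_bound => //; exists x. Qed.

Let moebius_distxx rho : moebius_dist rho rho = 0.
Proof.
have E : moebius_derivative rho rho = fun=> 1.
  by apply: derE; split=> // [x|x y]; [exact: cvg_cst|rewrite !mul1r].
have [a _] := Z4; apply/eqP; rewrite eq_le; apply/andP; split.
  apply: ge_sup; first by case: (has_supM rho rho).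
  by move=> _ [x _ <-]; rewrite E ln1 normr0.
exact: le_trans (dist_ub rho rho a).
Qed.

Let moebius_dist_eq0 rho1 rho2 : moebius_dist rho1 rho2 = 0 -> rho1 = rho2.
Proof.
move=> d0; have [_ l0 lE] := derP rho1 rho2.
have l1 x : moebius_derivative rho1 rho2 x = 1.
  have := dist_ub rho1 rho2 x; rewrite d0 normr_le0 ln_eq0//.
  by move/eqP.
apply: eqM => x y; apply/eqP.
have [[_ p1 _ _] [_ p2 _ _]] := (sepM rho1, sepM rho2).
by rewrite eq_sym -(@eqrXn2 _ 2)// lE !l1 !mul1r.
Qed.

Let moebius_dist_sym rho1 rho2 :
  moebius_dist rho1 rho2 = moebius_dist rho2 rho1.
Proof.
have [lc l0 lE] := derP rho1 rho2.
have E : moebius_derivative rho2 rho1 =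
    fun x => (moebius_derivative rho1 rho2 x)^-1.
  apply: derE; split.
  - by move=> t; exact: (cvgV (lt0r_neq0 (l0 t)) (lc t)).
  - by move=> t; rewrite invr_gt0.
  - move=> t u; rewrite lE; field.
    by rewrite !lt0r_neq0.
rewrite /moebius_dist E; congr (sup _); apply: eq_imagel => x _.
by rewrite lnV ?posrE// normrN.
Qed.

Let moebius_dist_triangle rho2 rho1 rho3 :
  moebius_dist rho1 rho3 <= moebius_dist rho1 rho2 + moebius_dist rho2 rho3.
Proof.
have [lc l0 lE] := derP rho1 rho2; have [mc m0 mE] := derP rho2 rho3.
have E : moebius_derivative rho1 rho3 =
    fun x => moebius_derivative rho1 rho2 x * moebius_derivative rho2 rho3 x.
  apply: derE; split.
  - by move=> t; exact: (cvgM (lc t) (mc t)).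
  - by move=> t; rewrite mulr_gt0.
  - by move=> t u; rewrite mE lE; ring.
apply: ge_sup; first by case: (has_supM rho1 rho3).
move=> _ [x _ <-]; rewrite E lnM ?posrE//.
by apply: le_trans (ler_normD _ _) _; exact: lerD.
Qed.

HB.instance Definition _ := @isMetric.Build R M moebius_dist moebius_distxx
  moebius_dist_eq0 moebius_dist_sym moebius_dist_triangle.

End moebius_metric.

Section gromov_hyperbolic.
Context {R : realType}.
Implicit Types X : metricType R.

Definition gromov_product X (x y z : X) : R :=
  (mdist x y + mdist x z - mdist y z) / 2.

Definition gromov_hyperbolic X : Prop :=
  exists2 delta : R, 0 <= delta & forall a b c x : X,
    Num.min (gromov_product x a c) (gromov_product x c b) - delta
      <= gromov_product x a b.

Definition proper_space X : Prop :=
  forall (x : X) (r : R), compact [set y | mdist x y <= r].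

Definition geodesic_space X : Prop :=
  forall x y : X, exists g : R -> X,
    [/\ g 0 = x, g (mdist x y) = y
      & {in `[0, mdist x y] &, forall s t, mdist (g s) (g t) = `|s - t|}].

(* Only the values of a ray on [0, +oo) are relevant. *)
Definition geodesic_ray X (g : R -> X) : Prop :=
  forall s t, 0 <= s -> 0 <= t -> mdist (g s) (g t) = `|s - t|.

Definition asymptotic X (g h : R -> X) : Prop :=
  exists C : R, forall t, 0 <= t -> mdist (g t) (h t) <= C.

End gromov_hyperbolic.

Section visual_boundary.
Context {R : realType}.
Variable X : metricType R.

Record visual_boundary := VisualBoundary {
  boundary_class :> set (R -> X);
  boundary_classP : exists2 g, geodesic_ray g &
    boundary_class = [set h | geodesic_ray h /\ asymptotic g h] }.

HB.instance Definition _ := gen_eqMixin visual_boundary.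
HB.instance Definition _ := gen_choiceMixin visual_boundary.

Definition visual_compactification : Type := (X + visual_boundary)%type.

HB.instance Definition _ := gen_eqMixin visual_compactification.
HB.instance Definition _ := gen_choiceMixin visual_compactification.

Definition of_space (x : X) : visual_compactification := inl x.
Definition of_boundary (xi : visual_boundary) : visual_compactification :=
  inr xi.

(* The standard neighbourhoods of a boundary point in the Gromov
   compactification of a proper geodesic hyperbolic space, for the base
   point [x] (see Kapovich and Benakli, "Boundaries of hyperbolic groups"). *)
Definition boundary_nbhd (x : X) (xi : visual_boundary) (r : R) :
    set visual_compactification :=
  [set p | exists g, [/\ boundary_class xi g, g 0 = x &
    match p with
    | inl y => (r%:E <=
        limf_einf (fun t => (gromov_product x (g t) y)%:E)
          (+oo%R : set_system R))%E
    | inr eta => exists h, [/\ boundary_class eta h, h 0 = x &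
        (r%:E <= limf_einf (fun t => (gromov_product x (g t) (h t))%:E)
          (+oo%R : set_system R))%E]
    end]].

(* Changing the base point changes Gromov products by a bounded amount, so the
   quantification over [x] only makes the definition independent of a choice. *)
Definition compactification_open (U : set visual_compactification) : Prop :=
  open (of_space @^-1` U) /\
  forall xi, U (of_boundary xi) ->
    forall x, exists r, boundary_nbhd x xi r `<=` U.

Let le_boundary_nbhd x xi (r s : R) : r <= s ->
  boundary_nbhd x xi s `<=` boundary_nbhd x xi r.
Proof.
move=> rs p [g [xig gx P]]; exists g; split=> //; move: P.
case: p => [y|eta]; first by apply: le_trans; rewrite lee_fin.
move=> [h [etah hx P]]; exists h; split=> //.
by apply: le_trans P; rewrite lee_fin.
Qed.

Let compactification_openT : compactification_open setT.
Proof. by split=> [|xi _ x]; [exact: openT|exists 0]. Qed.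

Let compactification_openI : setI_closed compactification_open.
Proof.
move=> U V [oU bU] [oV bV]; split; first exact: openI.
move=> xi [Uxi Vxi] x; have [r rU] := bU _ Uxi x; have [s sV] := bV _ Vxi x.
exists (Num.max r s) => p pN; split.
- by apply/rU/(le_boundary_nbhd _ pN); rewrite le_max lexx.
- by apply/sV/(le_boundary_nbhd _ pN); rewrite le_max lexx orbT.
Qed.

Let compactification_open_bigcup (I : Type)
    (f : I -> set visual_compactification) :
  (forall i, compactification_open (f i)) ->
  compactification_open (\bigcup_i f i).
Proof.
move=> fo; split.
  rewrite preimage_bigcup; apply: bigcup_open => i _; exact: (fo i).1.
move=> xi [i _ fxi] x; have [r rf] := (fo i).2 _ fxi x.
by exists r => p /rf fp; exists i.
Qed.

HB.instance Definition _ := @isOpenTopological.Build visual_compactification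
  compactification_open compactification_openT compactification_openI
  compactification_open_bigcup.

HB.instance Definition _ := Topological.copy visual_boundary
  (initial_topology of_boundary).

(* [G] is the continuous extension of the Gromov product based at [x]. *)
Definition gromov_extension (x : X)
    (G : visual_compactification -> visual_compactification -> \bar R) : Prop :=
  [/\ continuous (fun p : visual_compactification * visual_compactification =>
        G p.1 p.2),
      forall p q, (0 <= G p q)%E
    & forall y z : X,
        G (of_space y) (of_space z) = (gromov_product x y z)%:E].

Definition boundary_continuous_hyperbolic : Prop :=
  [/\ proper_space X, geodesic_space X, gromov_hyperbolic X
    & forall x, exists G, gromov_extension x G].

Definition extended_gromov_product (x : X) :
    visual_compactification -> visual_compactification -> \bar R :=
  xget (fun _ _ => 0%E) [set G | gromov_extension x G].

Definition visual_quasi_metric (x : X) (xi eta : visual_boundary) : R :=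
  fine (expeR
    (- extended_gromov_product x (of_boundary xi) (of_boundary eta))%E).

End visual_boundary.

Definition homeomorphism (S T : topologicalType) (f : S -> T) : Prop :=
  continuous f /\
  exists g : T -> S, [/\ cancel f g, cancel g f & continuous g].

(* The cross-ratio of the visual boundary is that of [visual_quasi_metric x]
   for any [x]. *)
Definition moebius_hyperbolic_filling (R : realType) (X : metricType R)
    (Z : antipodalSpace R) (f : visual_boundary X -> Z) : Prop :=
  [/\ boundary_continuous_hyperbolic X, homeomorphism f
    & forall x : X,
        moebius_map (visual_quasi_metric x) (@antipodal_fun R Z) f].

(* Main.v *)
Require Import Defs.
From mathcomp Require Import all_boot all_order all_algebra.
From mathcomp Require Import all_classical all_reals all_analysis.
From mathcomp Require Import ring lra.
(** Fix a point [o] of the Moebius space of [Z].  An antipodal function [r]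
    equivalent to [o] is determined by its logarithmic derivative
    [logder o r], and it is antipodal exactly when [f = - logder o r]
    satisfies [f x = max_y (2 * ln (o x y) - f y)] for all [x].  So the Moebius
    space is the tight span (injective hull) of [Z] for the kernel [2 * ln o],
    with the supremum distance, and it shares the properties of tight spans.

    There is a retraction that does not increase distances from the functions
    with [f x + f y >= 2 * ln (o x y)] onto the space
    ([extremal_part_lipschitz], [moebius_retract_lipschitz]).  Retracting
    straight segments gives geodesics ([moebius_space_geodesic]), and
    retracting the functions [- t] at [z], [t] elsewhere gives a ray from [o]
    along which the logarithmic derivative at [z] is [t]
    ([moebius_ray_exists]).  Bounded logarithmic derivatives are equicontinuous
    ([log_weight_equicontinuous]), so closed balls are compact
    ([moebius_space_proper]).

    The distance between two points is the supremum over [x] and [y] of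
    [logder o r x + logder o s y + 2 * ln (o x y)].  Hence a four-point
    inequality for [o], which follows from the quasi-metric inequality, passes
    to the Moebius space and makes it hyperbolic
    ([quasi_metric_moebius_hyperbolic]).  It also says that
    [exp (- gromov_product o r s)] is the maximum of [w x * v y * o x y], where
    [w] and [v] are the square roots of the derivatives, normalized to have
    maximum 1.  Allowing for [w] the indicator function of a point of [Z]
    extends this kernel to [Z], where it is equal to [o] itself
    ([hat_kernel]).  A weight whose kernel with a point [z] is small is
    concentrated near [z], so the kernel is continuous at [z], uniformly in its
    other argument ([hat_kernel_near]).  Letting points tend to [Z] in the
    hyperbolic inequality yields the quasi-metric inequality of [o]
    ([moebius_hyperbolic_quasi_metric]).

    Along a geodesic ray the points where the logarithmic derivative is maximal
    form decreasing compact sets, hence have a common point, the end of the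
    ray ([ray_end_exists]).  Asymptotic rays have the same end
    ([asymptotic_end]), and conversely when the space is hyperbolic
    ([ray_end_asymptotic]), so that sending a class of rays to its end is a
    bijection from the visual boundary to [Z].  Along a ray the kernel tends to
    its value at the end; therefore the neighbourhoods of boundary points are
    the sets where the kernel with that point is small, and minus the logarithm
    of the kernel is the continuous extension of the Gromov product
    ([compact_product_extension], [gromov_extension_unique]).  On the boundary
    the kernel is [o], which is the isometry for the base point and, for all
    [o] at once, the Moebius property. *)

Set Implicit Arguments.
Unset Strict Implicit.
Unset Printing Implicit Defensive.
Import Order.TTheory GRing.Theory Num.Theory.
Import numFieldNormedType.Exports.
Local Open Scope classical_set_scope.
Local Open Scope ring_scope.

(** * Logarithmic derivatives and distances *)

Lemma sqr_expR_half (R : realType) (a : R) : expR (a / 2) ^+ 2 = expR a.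
Proof. by rewrite expr2 -expRD -splitr. Qed.

Section log_derivative.
Context {R : realType} {Z : antipodalSpace R}.
Local Notation M := (moebius_space Z).
Implicit Types (o r : M) (x y : Z).

Lemma moebius_fun_separating r : separating r.
Proof. by case: (moebius_fun_antipodal r). Qed.

Lemma moebius_fun_equiv2 o r : moebius_equiv o r.
Proof. by move=> x x' y y' u; rewrite !moebius_fun_equiv. Qed.

Lemma moebius_fun_continuous r : continuous (fun p : Z * Z => r p.1 p.2).
Proof. by case: (moebius_fun_separating r). Qed.

Lemma moebius_fun_ge0 r x y : 0 <= r x y.
Proof. by case: (moebius_fun_separating r). Qed.

Lemma moebius_fun_sym r x y : r x y = r y x.
Proof. by case: (moebius_fun_separating r). Qed.

Lemma moebius_fun_eq0 r x y : r x y = 0 <-> x = y.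
Proof. by case: (moebius_fun_separating r). Qed.

Lemma moebius_funxx r x : r x x = 0.
Proof. exact/moebius_fun_eq0. Qed.

Lemma moebius_fun_gt0 r x y : (0 < r x y) = (x != y).
Proof. exact: (separating_gt0 _ _ (moebius_fun_separating r)). Qed.

Lemma moebius_fun_opposite r x : exists y, r x y = 1.
Proof. by case: (moebius_fun_antipodal r). Qed.

Lemma moebius_fun_le1 r x y : r x y <= 1.
Proof.
have [_ s1 _] := moebius_fun_antipodal r.
have hs : has_sup (range (fun p : Z * Z => r p.1 p.2)).
  apply/not_notP => /sup_out; rewrite s1 => /eqP; by rewrite oner_eq0.
by rewrite -s1; apply: sup_upper_bound => //; exists (x, y).
Qed.

Lemma antipodal_nonempty : [set: Z] !=set0.
Proof. by have [a _] := antipodal_four_points Z; exists a. Qed.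

(** Up to a sign, the Busemann function of [o] and [r] at the point [x] of the
    boundary. *)
Definition logder o r x : R := ln (moebius_derivative o r x).

Let derP o r : moebius_derivative_of o r (moebius_derivative o r).
Proof.
apply: moebius_derivativeP; [exact: antipodal_four_points|
  exact: moebius_fun_separating|exact: moebius_fun_separating|
  exact: moebius_fun_equiv2].
Qed.

Lemma logder_continuous o r : continuous (logder o r).
Proof.
have [c d0 _] := derP o r => x.
exact: (continuous_comp (c x) (continuous_ln _)).
Qed.

Lemma moebius_fun_logder o r x y :
  r x y = expR ((logder o r x + logder o r y) / 2) * o x y.
Proof.
have [_ l0 lE] := derP o r.
apply/eqP; rewrite -(@eqrXn2 _ 2) ?moebius_fun_ge0//; last first.
  by rewrite mulr_ge0 ?moebius_fun_ge0// expR_ge0.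
by rewrite lE exprMn sqr_expR_half expRD /logder !lnK ?posrE.
Qed.

Lemma logder_eq o r (f : Z -> R) : continuous f ->
  (forall x y, r x y = expR ((f x + f y) / 2) * o x y) -> logder o r = f.
Proof.
move=> cf fE; have E : moebius_derivative o r = fun x => expR (f x).
  apply: moebius_derivativeE; [exact: antipodal_four_points|
    exact: moebius_fun_separating|exact: moebius_fun_separating|
    exact: moebius_fun_equiv2|].
  split=> [x|x|x y]; last by rewrite fE exprMn sqr_expR_half expRD.
    apply: (@continuous_comp _ _ _ f expR); first exact: cf.
    exact: continuous_expR.
  exact: expR_gt0.
by apply/funext => x; rewrite /logder E expRK.
Qed.

Lemma logder_cocycle r o s x : logder o s x = logder o r x + logder r s x.
Proof.
rewrite (@logder_eq o s (fun x => logder o r x + logder r s x))//.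
  by move=> y; apply: cvgD; exact: logder_continuous.
move=> y z; rewrite (moebius_fun_logder r s) (moebius_fun_logder o r) mulrA.
by rewrite -expRD; congr (expR _ * _); lra.
Qed.

Lemma logderxx o x : logder o o x = 0.
Proof. have := logder_cocycle o o o x; lra. Qed.

Lemma logderN o r x : logder r o x = - logder o r x.
Proof. by have := logder_cocycle r o o x; rewrite logderxx; lra. Qed.

Lemma logderB o r s x : logder r s x = logder o s x - logder o r x.
Proof. by rewrite (logder_cocycle o r s) (logderN o r) addrC. Qed.

Lemma logder_attains_norm o r :
  exists2 x, forall y, `|logder o r y| <= `|logder o r x|
           & mdist o r = `|logder o r x|.
Proof.
have cn : continuous (fun x => `|logder o r x|).
  by move=> x; apply: cvg_norm; exact: logder_continuous.
have [x _ mx] := compact_EVT_max antipodal_nonempty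
  (@antipodal_compact R Z) (continuous_subspaceT cn).
have ub y : `|logder o r y| <= `|logder o r x| by apply: mx; rewrite in_setT.
exists x => //; apply/eqP; rewrite eq_le; apply/andP; split.
  apply: ge_sup; first by exists `|logder o r x|, x.
  by move=> _ [y _ <-]; exact: ub.
apply: sup_upper_bound; last by exists x.
split; first by exists `|logder o r x|, x.
by exists `|logder o r x| => _ [y _ <-]; exact: ub.
Qed.

Lemma normr_logder_le o r x : `|logder o r x| <= mdist o r.
Proof. by have [y yP ->] := logder_attains_norm o r. Qed.

Lemma logder_le o r x : logder o r x <= mdist o r.
Proof. exact: le_trans (ler_norm _) (normr_logder_le _ _ _). Qed.

Lemma mdist_le o r c : (forall x, `|logder o r x| <= c) -> mdist o r <= c.
Proof. by have [x _ ->] := logder_attains_norm o r. Qed.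

(** At a point [x] where the logarithmic derivative would reach [- mdist o r],
    a point opposite to [x] for [r] has logarithmic derivative at least
    [mdist o r], because [o] does not exceed 1: the supremum norm is always
    reached with a positive sign. *)
Lemma logder_max o r : exists x, logder o r x = mdist o r.
Proof.
have [x _ dE] := logder_attains_norm o r.
have [l0|l0] := leP 0 (logder o r x); first by exists x; rewrite dE ger0_norm.
have [y rxy] := moebius_fun_opposite r x; exists y.
apply/eqP; rewrite eq_le logder_le/= dE ltr0_norm//.
move: rxy; rewrite (moebius_fun_logder o r) => E.
have : 1 <= expR ((logder o r x + logder o r y) / 2).
  by rewrite -[leLHS]E ler_piMr ?expR_ge0 ?moebius_fun_le1.
by rewrite -[leLHS]expR0 ler_expR; lra.
Qed.

Lemma logder_inj o r s : logder o r = logder o s -> r = s.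
Proof.
move=> E; apply: mdist_positivity; apply/eqP; rewrite eq_le mdist_ge0 andbT.
by apply: mdist_le => x; rewrite (logderB o) E subrr normr0.
Qed.

Lemma mdist_le_logder o r s c :
  (forall x, `|logder o r x - logder o s x| <= c) -> mdist r s <= c.
Proof.
by move=> H; apply: mdist_le => x; rewrite (logderB o r s) distrC.
Qed.

Lemma logder_dist_le o r s x : `|logder o r x - logder o s x| <= mdist r s.
Proof.
by rewrite distrC -logderB; exact: normr_logder_le.
Qed.

(** At a maximum [x] of the logarithmic derivative of [r] with respect to [s]
    and a point [y] opposite to [x] for [s], the weights of [r] and [s]
    combine to the full distance.  With the bound of the next lemma, the
    distance becomes a supremum of weighted values of any third function [o],
    and this is what carries inequalities for [o] to the Moebius space. *)
Lemma mdist_attained o r s : exists x y,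
  expR ((logder o r x + logder o s y) / 2) * o x y = expR (mdist r s / 2).
Proof.
have [x xE] := logder_max s r; have [y yE] := moebius_fun_opposite s x.
exists x, y; move: xE yE; rewrite (logderB o s r).
rewrite (moebius_fun_logder o s) metric_sym => <- E.
rewrite -[RHS]mulr1 -[X in _ = _ * X]E mulrA -expRD; congr (expR _ * _); lra.
Qed.

Lemma mdist_ge_pair o r s x y :
  expR ((logder o r x + logder o s y) / 2) * o x y <= expR (mdist r s / 2).
Proof.
have -> : expR ((logder o r x + logder o s y) / 2) * o x y
    = expR (logder s r x / 2) * s x y.
  rewrite (moebius_fun_logder o s) mulrA -expRD (logderB o s r).
  congr (expR _ * _); lra.
apply: (@le_trans _ _ (expR (logder s r x / 2))).
  by rewrite ler_piMr ?expR_ge0 ?moebius_fun_le1.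
by rewrite ler_expR ler_pM2r// metric_sym logder_le.
Qed.

End log_derivative.

(** * Retraction onto the extremal functions of a kernel *)

Section tight_span.
Context {R : realType} {T : Type} (adj : T -> T -> Prop) (k : T -> T -> R).
Hypothesis adj_sym : forall x y, adj x y -> adj y x.
Hypothesis k_sym : forall x y, k x y = k y x.
Hypothesis k_zero : forall x, exists2 y, adj x y & k x y = 0.
Implicit Types f g : T -> R.

(** The tight span of the kernel [k]: its points are the majorants that are
    equal to their conjugate.  The relation [adj] removes the pairs at which a
    logarithmic kernel is infinite. *)
Definition majorant f := forall x y, adj x y -> k x y <= f x + f y.

Definition conjugate f x : R := sup [set k x y - f y | y in adj x].

Definition half_conjugate f x : R := (f x + conjugate f x) / 2.

(** Averaging a majorant with its conjugate at least halves the gap between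
    them, so that iteration retracts the majorants onto the extremal ones. *)
Definition extremal_iter f n := iter n half_conjugate f.

Definition extremal_part f x : R := inf (range (fun n => extremal_iter f n x)).

Let conjugate_has_sup f x :
  majorant f -> has_sup [set k x y - f y | y in adj x].
Proof.
move=> mf; split.
  by have [y xy _] := k_zero x; exists (k x y - f y), y.
by exists (f x) => _ [y xy <-]; rewrite lerBlDr mf.
Qed.

Lemma conjugate_ge f x y :
  majorant f -> adj x y -> k x y - f y <= conjugate f x.
Proof.
by move=> mf xy; apply: sup_upper_bound; [exact: conjugate_has_sup|exists y].
Qed.

Lemma conjugate_le f x c :
  (forall y, adj x y -> k x y - f y <= c) -> conjugate f x <= c.
Proof.
move=> H; apply: ge_sup; first by have [y xy _] := k_zero x;
  exists (k x y - f y), y.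
by move=> _ [y xy <-]; exact: H.
Qed.

Lemma conjugate_le_self f x : majorant f -> conjugate f x <= f x.
Proof. by move=> mf; apply: conjugate_le => y xy; rewrite lerBlDr mf. Qed.

Lemma half_conjugate_le f x : majorant f -> half_conjugate f x <= f x.
Proof. move=> /conjugate_le_self => /(_ x); rewrite /half_conjugate; lra. Qed.

(** Each of [f x + conjugate f y] and [conjugate f x + f y] is at least
    [k x y], hence so is their average. *)
Lemma half_conjugate_majorant f : majorant f -> majorant (half_conjugate f).
Proof.
move=> mf x y xy; have := conjugate_ge mf xy.
have := conjugate_ge mf (adj_sym xy); rewrite /half_conjugate (k_sym y x).
lra.
Qed.

Lemma half_conjugate_lipschitz f g c : majorant f -> majorant g ->
  (forall x, `|f x - g x| <= c) ->
  forall x, `|half_conjugate f x - half_conjugate g x| <= c.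
Proof.
have aux h h' : majorant h' -> (forall x, `|h x - h' x| <= c) ->
    forall x, conjugate h x <= conjugate h' x + c.
  move=> mh hh' x; apply: conjugate_le => y xy.
  have := conjugate_ge mh xy; have := hh' y; rewrite ler_norml; lra.
move=> mf mg fg x; have H1 := aux f g mg fg x.
have H2 : conjugate g x <= conjugate f x + c.
  by apply: aux => // z; rewrite distrC.
have := fg x; rewrite !ler_norml /half_conjugate; lra.
Qed.

Lemma extremal_iter_majorant f n : majorant f -> majorant (extremal_iter f n).
Proof. by move=> mf; elim: n => //= n; exact: half_conjugate_majorant. Qed.

Lemma extremal_iter_le f m n x :
  majorant f -> (m <= n)%N -> extremal_iter f n x <= extremal_iter f m x.
Proof.
move=> mf; elim: n => [|n IH]; first by rewrite leqn0 => /eqP ->.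
rewrite leq_eqVlt => /predU1P[->//|]; rewrite ltnS => /IH; apply: le_trans.
by apply: half_conjugate_le; exact: extremal_iter_majorant.
Qed.

Lemma extremal_iter_ge f b n x :
  majorant f -> (forall y, f y <= b) -> - b <= extremal_iter f n x.
Proof.
move=> mf fb; have [y xy k0] := k_zero x.
have := extremal_iter_majorant n mf xy; rewrite k0.
have := extremal_iter_le y mf (leq0n n); have := fb y; rewrite /=; lra.
Qed.

Lemma extremal_iter_lipschitz f g c n : majorant f -> majorant g ->
  (forall x, `|f x - g x| <= c) ->
  forall x, `|extremal_iter f n x - extremal_iter g n x| <= c.
Proof.
move=> mf mg fg; elim: n => //= n IH.
by apply: half_conjugate_lipschitz => //; exact: extremal_iter_majorant.
Qed.

Section bounded_majorant.
Variables (f : T -> R) (b : R).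
Hypotheses (mf : majorant f) (fb : forall y, f y <= b).

Let has_infF x : has_inf (range (fun n => extremal_iter f n x)).
Proof.
split; first by exists (extremal_iter f 0 x), 0%N.
by exists (- b) => _ [n _ <-]; exact: extremal_iter_ge.
Qed.

Lemma extremal_part_le_iter n x : extremal_part f x <= extremal_iter f n x.
Proof. by apply: inf_lbound; [case: (has_infF x)|exists n]. Qed.

Lemma extremal_part_ge x c :
  (forall n, c <= extremal_iter f n x) -> c <= extremal_part f x.
Proof.
move=> H; apply: lb_le_inf; first by case: (has_infF x).
by move=> _ [n _ <-]; exact: H.
Qed.

Lemma extremal_part_approx x e : 0 < e ->
  exists n, forall m, (n <= m)%N ->
    extremal_iter f m x <= extremal_part f x + e.
Proof.
move=> e0; have [_ [n _ <-] nE] := inf_adherent e0 (has_infF x).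
by exists n => m nm; apply: le_trans (ltW nE); exact: extremal_iter_le.
Qed.

Lemma extremal_part_le x : extremal_part f x <= f x.
Proof. exact: (extremal_part_le_iter 0). Qed.

Lemma extremal_part_bound x : `|extremal_part f x| <= b.
Proof.
rewrite ler_norml (le_trans (extremal_part_le x))// andbT.
by apply: extremal_part_ge => n; exact: extremal_iter_ge.
Qed.

Lemma extremal_part_majorant : majorant (extremal_part f).
Proof.
move=> x y xy; apply/ler_addgt0Pr => e e0.
have e20 : 0 < e / 2 by lra.
have [n nP] := extremal_part_approx x e20.
have [m mP] := extremal_part_approx y e20.
have := extremal_iter_majorant (maxn n m) mf xy.
have := nP _ (leq_maxl n m); have := mP _ (leq_maxr n m); lra.
Qed.

(** Once an iterate is close to the infimum at [x], so is the next one; their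
    difference is half the gap between the iterate and its conjugate, which is
    therefore small. *)
Lemma extremal_part_tight x e : 0 < e ->
  exists2 y, adj x y & extremal_part f x + extremal_part f y <= k x y + e.
Proof.
move=> e0; have e40 : 0 < e / 4 by lra.
have [n nP] := extremal_part_approx x e40.
have mg := extremal_iter_majorant n mf.
have [c0 cb] := conjugate_has_sup x mg.
have [_ [y xy <-] yE] := sup_adherent e40 (conj c0 cb).
exists y => //; move: yE; rewrite -/(conjugate _ x).
have := nP _ (leqnn n).
have := extremal_part_le_iter n.+1 x.
have := extremal_part_le_iter n x; have := extremal_part_le_iter n y.
rewrite /= /half_conjugate; lra.
Qed.

End bounded_majorant.

Lemma extremal_part_lipschitz f g b c : majorant f -> majorant g ->
  (forall x, f x <= b) -> (forall x, g x <= b) ->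
  (forall x, `|f x - g x| <= c) ->
  forall x, `|extremal_part f x - extremal_part g x| <= c.
Proof.
move=> mf mg fb gb fg x.
have aux h h' : majorant h -> majorant h' -> (forall x, h x <= b) ->
    (forall x, h' x <= b) -> (forall x, `|h x - h' x| <= c) ->
    extremal_part h x - c <= extremal_part h' x.
  move=> mh mh' hb hb' hh'; apply: (extremal_part_ge mh' hb') => n.
  have := extremal_iter_lipschitz n mh mh' hh' x.
  have := extremal_part_le_iter mh hb n x; rewrite ler_norml; lra.
have H1 := aux f g mf mg fb gb fg.
have H2 : extremal_part g x - c <= extremal_part f x.
  by apply: aux => // z; rewrite distrC.
rewrite ler_norml; lra.
Qed.

Lemma extremal_part_id f : majorant f ->
  (forall x e, 0 < e -> exists2 y, adj x y & f x + f y <= k x y + e) ->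
  extremal_part f = f.
Proof.
move=> mf tf; have cf : half_conjugate f = f.
  apply/funext => x; have := conjugate_le_self x mf.
  suff : f x <= conjugate f x by rewrite /half_conjugate; lra.
  apply/ler_addgt0Pr => e e0; have [y xy] := tf x e e0.
  have := conjugate_ge mf xy; lra.
have it n : extremal_iter f n = f by elim: n => //= n ->.
apply/funext => x; rewrite /extremal_part.
have -> : range (fun n => extremal_iter f n x) = [set f x]; last exact: inf1.
apply/seteqP; split=> [_ [n _ <-]|_ ->]; first by rewrite it.
by exists 0%N.
Qed.

End tight_span.

(** * Equicontinuity and realization of logarithmic derivatives *)

Section compactness.
Context {R : realType} {Z : antipodalSpace R}.
Local Notation M := (moebius_space Z).
Implicit Types (o r : M) (x y : Z).

Let near_covering_Z : near_covering [set: Z].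
Proof. exact/compact_near_coveringP/antipodal_compact. Qed.

(** Antipodal functions induce the topology: away from a neighbourhood of [x]
    the function [o x] is locally bounded below by a positive number, and
    compactness makes the bound uniform. *)
Lemma moebius_fun_nbhs o x (W : set Z) : nbhs x W ->
  exists2 d, 0 < d & forall y, o x y < d -> W y.
Proof.
move=> Wx; have cx y : (fun z => o x z) z @[z --> y] --> o x y.
  have := @separating_continuousl R Z o x (moebius_fun_separating o) y.
  rewrite /continuous_at moebius_fun_sym.
  by under [X in X @ _]eq_fun do rewrite moebius_fun_sym.
have H : \forall d \near (0 : R)^'+,
    [set: Z] `<=` (fun y => o x y < d -> W y).
  apply: near_covering_Z => y _; have [<-|xy] := eqVneq x y.
    exists (W, setT) => /=; first by split=> //; exact: filterT.
    by move=> [z d] [/= Wz _] _.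
  have oxy : 0 < o x y by rewrite moebius_fun_gt0.
  exists ([set z | o x y / 2 < o x z], [set d | d <= o x y / 2]) => /=.
    split; last by apply: nbhs_right_le; lra.
    by apply: cvgr_gt (cx y) _ _; lra.
  move=> [z d] [/= H1 H2] H3; lra.
have [d [dW d0]] := filter_ex (filterI H (nbhs_right_gt 0)).
by exists d => // y; exact: dW.
Unshelve. all: by end_near. Qed.

Lemma moebius_fun_uniform o x (e : R) : 0 < e ->
  \forall x' \near x, forall y, `|o x y - o x' y| <= e.
Proof.
move=> e0.
suff : \forall x' \near x, [set: Z] `<=` (fun y => `|o x y - o x' y| <= e).
  by apply: filterS => x' H y; exact: H.
apply: near_covering_Z => y _.
have e20 : 0 < e / 2 by lra.
have cy := @moebius_fun_continuous R Z o (y, x).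
have /= := @cvgr_dist_le _ _ _ _ _ _ _ cy _ e20.
have c2 := @separating_continuousl R Z o x (moebius_fun_separating o) y.
have H2 := @cvgr_dist_le _ _ _ _ _ _ _ c2 _ e20.
case=> -[U V] /= [Uy Vx] UV.
exists (U `&` [set z | `|o y x - o z x| <= e / 2], V) => /=.
  split; last exact: Vx. by apply: filterI; [exact: Uy|exact: H2].
move=> [z x'] /= [[Uz H3] Vx'].
have := UV (z, x') (conj Uz Vx') => /= H4.
rewrite (moebius_fun_sym o x) (moebius_fun_sym o x').
have -> : o z x - o z x' = (o z x - o y x) + (o y x - o z x') by lra.
apply: le_trans (ler_normD _ _) _.
by rewrite [e]splitr distrC; apply: lerD.
Qed.

(** The logarithmic derivatives of the antipodal functions equivalent to [o],
    with the continuity and the existence of opposite points weakened so that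
    the conditions pass to pointwise limits. *)
Definition log_weight o (b : R) (f : Z -> R) :=
  [/\ forall x, `|f x| <= b,
      forall x y, expR ((f x + f y) / 2) * o x y <= 1
    & forall x e, 0 < e ->
        exists y, expR (- e) <= expR ((f x + f y) / 2) * o x y].

Lemma logder_log_weight o r : log_weight o (mdist o r) (logder o r).
Proof.
split=> [x|x y|x e e0]; first exact: normr_logder_le.
  by rewrite -moebius_fun_logder moebius_fun_le1.
have [y rxy] := moebius_fun_opposite r x; exists y.
by rewrite -moebius_fun_logder rxy -[leRHS]expR0 ler_expR; lra.
Qed.

(** A point [y] that is almost opposite to [x] cannot be too close to [x],
    because [f] is bounded; for [x'] near [x] the ratio of [o x y] and [o x' y]
    is then close to 1, and this bounds [f x' - f x].  The neighbourhood
    depends on [f] only through the bound [b]. *)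
Lemma log_weight_equicontinuous o b x (e : R) : 0 < e ->
  \forall x' \near x, forall f, log_weight o b f -> `|f x - f x'| <= e.
Proof.
move=> e0; pose c := expR (- 1 - b).
pose h := (1 - expR (- (e / 4))) * c.
have h0 : 0 < h.
  rewrite mulr_gt0 ?expR_gt0// subr_gt0 -[ltRHS]expR0 ltr_expR; lra.
have key f x1 x2 : log_weight o b f ->
    (forall y, `|o x1 y - o x2 y| <= h) -> f x2 - f x1 <= e.
  move=> [fb f1 fopp] H; pose e' := Num.min 1 (e / 4).
  have e'0 : 0 < e' by rewrite lt_min; apply/andP; split; lra.
  have e'1 : e' <= 1 by rewrite ge_min lexx.
  have e'e : e' <= e / 4 by rewrite ge_min lexx orbT.
  have [y yP] := fopp x1 e' e'0.
  have cy : c <= o x1 y.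
    have : expR (- e') <= expR b * o x1 y.
      apply: le_trans yP _; apply: ler_wpM2r; first exact: moebius_fun_ge0.
      have := fb x1; have := fb y; rewrite ler_expR !ler_norml; lra.
    move=> co; rewrite -(ler_pM2l (expR_gt0 b)); apply: le_trans co.
    by rewrite /c -expRD ler_expR; lra.
  have oy : expR (- (e / 4)) * o x1 y <= o x2 y.
    have := H y; rewrite ler_norml => /andP[_ Hy].
    have : h <= (1 - expR (- (e / 4))) * o x1 y.
      apply: ler_wpM2l => //; rewrite subr_ge0 -[leRHS]expR0 ler_expR; lra.
    lra.
  have : expR ((f x2 - f x1) / 2 - e / 4 - e') <= 1.
    apply: le_trans (f1 x2 y).
    apply: (@le_trans _ _ (expR ((f x2 + f y) / 2)
                             * (expR (- (e / 4)) * o x1 y))); last first.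
      by rewrite ler_pM2l ?expR_gt0.
    rewrite [leLHS]expRD.
    have -> : expR ((f x2 + f y) / 2) * (expR (- (e / 4)) * o x1 y)
        = expR ((f x2 - f x1) / 2 - e / 4)
          * (expR ((f x1 + f y) / 2) * o x1 y).
      by rewrite !mulrA -!expRD; congr (expR _ * _); lra.
    by rewrite ler_pM2l ?expR_gt0.
  by rewrite -[leRHS]expR0 ler_expR; lra.
near=> x' => f wf; have H : forall y, `|o x y - o x' y| <= h.
  by near: x'; exact: moebius_fun_uniform.
have := key f x x' wf H.
have := key f x' x wf; rewrite ler_norml.
have H' y : `|o x' y - o x y| <= h by rewrite distrC.
move=> /(_ H'); lra.
Unshelve. all: by end_near. Qed.

Lemma log_weight_continuous o b f : log_weight o b f -> continuous f.
Proof.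
move=> wf x; apply/cvgrPdist_le => e e0.
apply: filterS (log_weight_equicontinuous o b x e0) => x' H; exact: H.
Qed.

(** Equicontinuity makes [f] continuous, and compactness turns almost opposite
    points into opposite ones. *)
Lemma log_weight_realized o b f :
  log_weight o b f -> exists r : M, logder o r = f.
Proof.
move=> wf; have cf := log_weight_continuous wf; have [_ f1 fopp] := wf.
pose rho x y := expR ((f x + f y) / 2) * o x y.
have crho : continuous (fun p : Z * Z => rho p.1 p.2).
  move=> p; apply: cvgM; last exact: (@moebius_fun_continuous R Z o).
  apply: (@continuous_comp _ _ _ (fun p : Z * Z => (f p.1 + f p.2) / 2) expR);
    last exact: continuous_expR.
  apply: cvgM; last exact: cvg_cst.
  apply: cvgD; apply: (@continuous_comp _ _ _ _ f); try exact: cf.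
    exact: cvg_fst.
  exact: cvg_snd.
have srho : separating rho.
  split=> // [x y|x y|x y].
  - by rewrite mulr_ge0 ?expR_ge0 ?moebius_fun_ge0.
  - by rewrite /rho addrC moebius_fun_sym.
  - rewrite -(moebius_fun_eq0 o); split=> [/eqP|]; last first.
      by rewrite /rho => ->; rewrite mulr0.
    by rewrite mulf_eq0 gt_eqF ?expR_gt0//= => /eqP.
have oppr x : exists y, rho x y = 1.
  have cx : continuous (rho x).
    move=> y; have := @separating_continuousl R Z rho x srho y.
    have [_ _ rs _] := srho; rewrite /continuous_at rs.
    by under [X in X @ _]eq_fun do rewrite rs.
  have [y _ ymax] := compact_EVT_max antipodal_nonempty
    (@antipodal_compact R Z) (continuous_subspaceT cx).
  exists y; apply/eqP; rewrite eq_le f1/=; apply/ler_addgt0Pr => e e0.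
  have [z zP] := fopp x e e0; have := ymax z; rewrite in_setT => /(_ isT).
  move: zP; rewrite -/(rho x z); have := expR_ge1Dx (- e); lra.
have arho : antipodal rho.
  split=> //; apply/eqP; rewrite eq_le; apply/andP; split.
    apply: ge_sup; last by move=> _ [[x y] _ <-]; exact: f1.
    by have [x _] := @antipodal_nonempty R Z; exists (rho x x), (x, x).
  have [x _] := @antipodal_nonempty R Z; have [y <-] := oppr x.
  apply: ub_le_sup; last by exists (x, y).
  by exists 1 => _ [[u v] _ <-]; exact: f1.
have erho : moebius_equiv rho (@antipodal_fun R Z).
  move=> x x' y y' u; rewrite -(moebius_fun_equiv o u) /cross_ratio /rho.
  move: u; rewrite /= !inE !negb_or.
  move=> /and4P[/and3P[xx' xy xy'] /andP[x'y x'y'] yy' _].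
  have n a b' : a != b' -> o a b' != 0.
    by rewrite -(moebius_fun_gt0 o) => /lt0r_neq0.
  have E a b' : expR ((f a + f b') / 2) = expR (f a / 2) * expR (f b' / 2).
    by rewrite -expRD mulrDl.
  rewrite !E; field; rewrite !n//=.
  by rewrite !gt_eqF ?expR_gt0.
exists (MoebiusSpace arho erho); exact: logder_eq.
Qed.

End compactness.

(** * Retraction onto the Moebius space *)

Section retraction.
Context {R : realType} {Z : antipodalSpace R}.
Local Notation M := (moebius_space Z).
Variable o : M.
Implicit Types (r : M) (x y : Z) (f g : Z -> R).

Definition log_subweight f :=
  forall x y, expR ((f x + f y) / 2) * o x y <= 1.

(* The kernel [2 * ln (o x y)] is [-oo] on the diagonal. *)
Let adj x y := x <> y.
Let k x y : R := 2 * ln (o x y).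

Let adj_sym x y : adj x y -> adj y x.
Proof. by move=> xy yx; exact: xy. Qed.

Let k_sym x y : k x y = k y x.
Proof. by rewrite /k moebius_fun_sym. Qed.

Let k_zero x : exists2 y, adj x y & k x y = 0.
Proof.
have [y oxy] := moebius_fun_opposite o x.
exists y; last by rewrite /k oxy ln1 mulr0.
move=> xy; move: oxy; rewrite xy moebius_funxx => /eqP.
by rewrite eq_sym oner_eq0.
Qed.

Let pair_expR f x y : adj x y ->
  expR ((f x + f y) / 2) * o x y = expR ((f x + f y + k x y) / 2).
Proof.
move=> /eqP; rewrite -(moebius_fun_gt0 o) => oxy.
rewrite [in RHS]mulrDl [in RHS]expRD; congr (_ * _).
by rewrite /k mulrAC divff ?mul1r ?lnK ?posrE.
Qed.

Let subweight_majorant f :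
  log_subweight f <-> majorant adj k (fun x => - f x).
Proof.
split=> [H x y xy|H x y].
  have := H x y; rewrite pair_expR// -[leRHS]expR0 ler_expR; lra.
have [->|/eqP xy] := eqVneq x y; first by rewrite moebius_funxx mulr0.
by rewrite pair_expR// -[leRHS]expR0 ler_expR; have := H x y xy; lra.
Qed.

Let upper f x : R := - extremal_part adj k (fun z => - f z) x.

Let upper_log_weight f b :
  log_subweight f -> (forall x, `|f x| <= b) -> log_weight o b (upper f).
Proof.
move=> /subweight_majorant mf fb.
have fb' x : - f x <= b by have := fb x; rewrite ler_norml; lra.
split=> [x|x y|x e e0].
- by rewrite /upper normrN; exact: (extremal_part_bound adj_sym k_sym).
- suff : log_subweight (upper f) by exact.
  apply/subweight_majorant => u v uv; rewrite /upper !opprK.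
  exact: (extremal_part_majorant adj_sym k_sym k_zero mf fb').
- have e20 : 0 < 2 * e by lra.
  have [y xy yP] :=
    extremal_part_tight adj_sym k_sym k_zero mf fb' x e20.
  by exists y; rewrite pair_expR// ler_expR /upper; lra.
Qed.

(** A retraction of the bounded admissible functions onto the Moebius space,
    which does not increase distances; signs are changed because the tight
    span describes the functions [- logder o r]. *)
Definition moebius_retract f : M := xget o [set r | logder o r = upper f].

Let logder_retract f b : log_subweight f -> (forall x, `|f x| <= b) ->
  logder o (moebius_retract f) = upper f.
Proof.
move=> sf fb; apply: (@xgetPex _ o [set r | logder o r = upper f]).
exact: log_weight_realized (upper_log_weight sf fb).
Qed.

Lemma logder_retract_ge f b x :
  log_subweight f -> (forall x, `|f x| <= b) ->
  f x <= logder o (moebius_retract f) x.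
Proof.
move=> sf fb; rewrite (logder_retract sf fb) /upper.
have fb' z : - f z <= b by have := fb z; rewrite ler_norml; lra.
have/subweight_majorant mf := sf.
by have := extremal_part_le adj_sym k_sym k_zero mf fb' x; lra.
Qed.

Lemma moebius_retract_lipschitz f g b c :
  log_subweight f -> log_subweight g ->
  (forall x, `|f x| <= b) -> (forall x, `|g x| <= b) ->
  (forall x, `|f x - g x| <= c) ->
  mdist (moebius_retract f) (moebius_retract g) <= c.
Proof.
move=> sf sg fb gb fg; apply: (@mdist_le_logder _ _ o) => x.
rewrite (logder_retract sf fb) (logder_retract sg gb) /upper -opprD normrN.
have fb' z : - f z <= b by have := fb z; rewrite ler_norml; lra.
have gb' z : - g z <= b by have := gb z; rewrite ler_norml; lra.
apply: (extremal_part_lipschitz adj_sym k_sym k_zero) fb' gb' _ _;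
  do ?exact/subweight_majorant.
by move=> z; rewrite -opprD normrN.
Qed.

Lemma log_subweight_logder r : log_subweight (logder o r).
Proof. by have [_] := logder_log_weight o r. Qed.

Lemma moebius_retract_logder r : moebius_retract (logder o r) = r.
Proof.
apply: (@logder_inj _ _ o).
rewrite (logder_retract (@log_subweight_logder r) (normr_logder_le o r)).
apply/funext => x; rewrite /upper extremal_part_id ?opprK//.
  by apply/subweight_majorant; exact: log_subweight_logder.
move=> z e e0; have [y ry] := moebius_fun_opposite r z; exists y.
  move=> zy; move: ry; rewrite zy moebius_funxx => /eqP.
  by rewrite eq_sym oner_eq0.
have zy : adj z y.
  move=> zy; move: ry; rewrite zy moebius_funxx => /eqP.
  by rewrite eq_sym oner_eq0.
move: ry; rewrite (moebius_fun_logder o) pair_expR// -[RHS]expR0.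
by move/expR_inj; lra.
Qed.


End retraction.

(** * Geodesics, rays and properness *)

Section geodesics.
Context {R : realType}.

(** A curve that does not increase distances and whose ends are as far apart
    as its length allows has no room for shortcuts. *)
Lemma lipschitz_geodesic (X : metricType R) (g : R -> X) (T s t : R) :
  (forall u v, 0 <= u -> 0 <= v -> mdist (g u) (g v) <= `|u - v|) ->
  T <= mdist (g 0) (g T) ->
  0 <= s -> s <= t -> t <= T -> mdist (g s) (g t) = `|s - t|.
Proof.
move=> lip gT s0 st tT; apply/eqP; rewrite eq_le lip ?(le_trans s0)//=.
have := lip 0 s; have := lip t T; have := metric_triangle (g 0) (g s) (g T).
have := metric_triangle (g s) (g t) (g T).
rewrite [`|t - T|]distrC [`|s - t|]distrC [`|0 - s|]distrC subr0.
rewrite !ger0_norm; lra.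
Qed.

Context {Z : antipodalSpace R}.
Local Notation M := (moebius_space Z).
Implicit Types (o r : M) (x y xi : Z) (f : Z -> R).

Lemma log_subweight_scale o f (c : R) :
  log_subweight o f -> 0 <= c <= 1 -> log_subweight o (fun x => c * f x).
Proof.
move=> sf /andP[c0 c1] x y; rewrite -mulrDr.
have [a0|a0] := leP (f x + f y) 0.
  rewrite -[leRHS]mulr1 ler_pM ?expR_ge0 ?moebius_fun_ge0 ?moebius_fun_le1//.
  by rewrite -[leRHS]expR0 ler_expR ler_pdivrMr// mul0r mulr_ge0_le0.
apply: le_trans (sf x y); apply: ler_wpM2r; first exact: moebius_fun_ge0.
by rewrite ler_expR ler_pM2r// ler_piMl// ltW.
Qed.

(** The logarithmic derivatives admissible for the retraction form a set that
    is star-shaped around 0, so a straight segment can be retracted. *)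
Lemma moebius_space_geodesic : geodesic_space (moebius_space Z).
Proof.
move=> o r; pose D := mdist o r; have D0 : 0 <= D by exact: mdist_ge0.
(* Clipping the parameter keeps the scaled functions admissible for all [s]. *)
pose clip (s : R) := Num.min s D / D.
have clip01 s : 0 <= s -> 0 <= clip s <= 1.
  move=> s0; rewrite /clip; have [D00|Dn] := eqVneq D 0.
    by rewrite D00 invr0 mulr0 lexx ler01.
  have Dp : 0 < D by rewrite lt_neqAle eq_sym Dn.
  rewrite divr_ge0 ?le_min ?s0//=.
  by rewrite ler_pdivrMr// mul1r ge_min lexx orbT.
pose g (s : R) : M := moebius_retract o (fun x => clip s * logder o r x).
have b s x : 0 <= s -> `|clip s * logder o r x| <= D.
  move=> /clip01/andP[c0 c1]; rewrite normrM ger0_norm//.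
  rewrite -[leRHS]mul1r; apply: ler_pM => //; exact: normr_logder_le.
have lip u v : 0 <= u -> 0 <= v -> mdist (g u) (g v) <= `|u - v|.
  move=> u0 v0.
  apply: (@moebius_retract_lipschitz _ _ _ _ _ D); try by move=> x; exact: b.
  - by apply: log_subweight_scale; [exact: log_subweight_logder|exact: clip01].
  - by apply: log_subweight_scale; [exact: log_subweight_logder|exact: clip01].
  move=> x; rewrite -mulrBl normrM.
  apply: (@le_trans _ _ (`|clip u - clip v| * D)).
    by apply: ler_wpM2l => //; exact: normr_logder_le.
  rewrite /clip -mulrBl normrM -mulrA; have [D00|Dn] := eqVneq D 0.
    by rewrite D00 !mulr0.
  rewrite normfV (ger0_norm D0) mulVf// mulr1.
  rewrite ler_norml /Num.min; case: ltP => ?; case: ltP => ?;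
    have := ler_norm (u - v); have := ler_norm (v - u);
    rewrite (distrC v u); lra.
have g0 : g 0 = o.
  rewrite -[RHS](moebius_retract_logder o o) /g; congr moebius_retract.
  by apply/funext => x; rewrite logderxx /clip min_l// mul0r mul0r.
have gD : g D = r.
  rewrite -[RHS](moebius_retract_logder o r) /g; congr moebius_retract.
  apply/funext => x; rewrite /clip min_l//.
  have [D00|Dn] := eqVneq D 0; last by rewrite divff// mul1r.
  rewrite D00 mul0r mul0r; have := normr_logder_le o r x.
  by rewrite -/D D00 normr_le0 => /eqP.
exists g; split=> // s t; rewrite !in_itv/= => /andP[s0 sD] /andP[t0 tD].
have H : D <= mdist (g 0) (g D) by rewrite g0 gD.
have [st|ts] := leP s t; first exact: (lipschitz_geodesic lip H).
rewrite metric_sym distrC.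
by apply: (lipschitz_geodesic lip H) => //; exact: ltW.
Qed.

(** The function equal to [t] at [xi] and to [- t] elsewhere is far from
    continuous, but it is admissible for the retraction, which can only
    increase the value at [xi]; this value already forces the distance to [o]
    to be at least [t]. *)
Lemma moebius_ray_exists o xi : exists g : R -> M,
  [/\ geodesic_ray g, g 0 = o & forall t, 0 <= t -> logder o (g t) xi = t].
Proof.
pose f (t : R) x : R := if x == xi then t else - t.
pose g t : M := moebius_retract o (f t).
have sf t : 0 <= t -> log_subweight o (f t).
  move=> t0 x y; have [->|xy] := eqVneq x y.
    by rewrite moebius_funxx mulr0.
  rewrite -[leRHS]mulr1 ler_pM ?expR_ge0 ?moebius_fun_ge0 ?moebius_fun_le1//.
  rewrite -[leRHS]expR0 ler_expR /f; move: xy.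
  case: (eqVneq x xi) => [->|_]; case: (eqVneq y xi) => [yE|_];
    rewrite ?yE ?eqxx//; lra.
have fb t x : `|f t x| <= `|t| by rewrite /f; case: ifP => _; rewrite ?normrN.
have lip u v : 0 <= u -> 0 <= v -> mdist (g u) (g v) <= `|u - v|.
  move=> u0 v0; apply: (@moebius_retract_lipschitz _ _ _ _ _ (`|u| + `|v|));
    try exact: sf.
  - by move=> x; apply: le_trans (fb _ _) _; rewrite lerDl.
  - by move=> x; apply: le_trans (fb _ _) _; rewrite lerDr.
  - by move=> x; rewrite /f; case: ifP => _//; rewrite -opprD normrN.
have g0 : g 0 = o.
  rewrite -[RHS](moebius_retract_logder o o) /g; congr moebius_retract.
  by apply/funext => x; rewrite logderxx /f oppr0; case: ifP.
have gxi t : 0 <= t -> t <= logder o (g t) xi.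
  move=> t0; have := @logder_retract_ge _ _ o _ _ xi (sf t t0) (fb t).
  by rewrite /f eqxx.
have gd t : 0 <= t -> t <= mdist (g 0) (g t).
  by move=> t0; rewrite g0; apply: le_trans (gxi t t0) _; exact: logder_le.
exists g; split=> // [s t s0 t0|t t0].
  have [st|ts] := leP s t; first exact: (lipschitz_geodesic lip (gd t t0)).
  rewrite metric_sym distrC.
  by apply: (lipschitz_geodesic lip (gd s s0)) => //; exact: ltW.
apply/eqP; rewrite eq_le gxi// andbT; apply: le_trans (logder_le _ _ _) _.
by have := lip 0 t (lexx 0) t0; rewrite g0 sub0r normrN ger0_norm.
Qed.

End geodesics.

Section properness.
Context {R : realType} {Z : antipodalSpace R}.
Local Notation M := (moebius_space Z).

Let ultra_bounded_cvg (F : set_system M) (A : set M) (h : M -> R) (b : R) :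
  UltraFilter F -> F A -> (forall s, A s -> `|h s| <= b) ->
  exists p, forall e : R, 0 < e -> F [set s | `|p - h s| < e].
Proof.
move=> UF FA hb.
have PF : ProperFilter (h @ F) by exact: fmap_proper_filter.
have hF : F (h @^-1` [set` `[- b, b]]).
  by apply: filterS FA => s /hb; rewrite /= in_itv/= ler_norml.
have [p [_ clp]] := @segment_compact R (- b) b _ PF hF.
exists p => e e0; have [//|C] := in_ultra_setVsetC [set s | `|p - h s| < e] UF.
have [v [/= v1 v2]] := clp [set v | ~ `|p - v| < e] (ball p e) C
  (nbhsx_ballx p e e0).
by case: v1; move: v2; rewrite -ball_normE.
Qed.

(** Arzela-Ascoli: along an ultrafilter on a ball the logarithmic derivatives
    converge pointwise, hence uniformly by equicontinuity; the limit still has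
    almost opposite points everywhere, so it is realized in the space. *)
Lemma moebius_space_proper : proper_space (moebius_space Z).
Proof.
move=> o b; rewrite compact_ultra => F UF FA.
pose A := [set s : M | mdist o s <= b].
have /choice [f fP] x : exists p, forall e : R, 0 < e ->
    F [set s | `|p - logder o s x| < e].
  apply: (ultra_bounded_cvg UF FA) => s; apply: le_trans.
  exact: normr_logder_le.
have Aw s : A s -> log_weight o b (logder o s).
  move=> As; have [sb s1 s2] := logder_log_weight o s; split=> // x.
  exact: le_trans (sb x) As.
have unif e : 0 < e -> F [set s | forall x, `|f x - logder o s x| <= e].
  move=> e0; have e50 : 0 < e / 5 by lra.
  have ncZ : near_covering [set: Z].
    exact/compact_near_coveringP/antipodal_compact.
  have : \forall s \near F, [set: Z] `<=` (fun x => `|f x - logder o s x| <= e).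
    apply: ncZ => x _.
    exists ([set x' | forall h, log_weight o b h -> `|h x - h x'| <= e / 5],
            A `&` [set s | `|f x - logder o s x| < e / 5]) => /=.
      split; first exact: log_weight_equicontinuous.
      by apply: filterI => //; exact: fP.
    move=> [x' s] /= [Hx' [As Hs]].
    have [s' [[H1 H2] As']] := filter_ex (filterI (filterI (fP x _ e50)
      (fP x' _ e50)) FA).
    have := Hx' _ (Aw s As); have := Hx' _ (Aw s' As').
    move: Hs H1 H2; rewrite /= !ltr_norml !ler_norml; lra.
  by apply: filterS => s H x; exact: H.
have wf : log_weight o (b + 1) f.
  split=> [x|x y|x e e0].
  - have [s [H As]] := filter_ex (filterI (unif 1 ltr01) FA).
    have [sb _ _] := Aw s As; have := sb x; have := H x.
    rewrite !ler_norml; lra.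
  - rewrite leNgt; apply/negP => v1.
    set v := expR _ * _ in v1; have v0 : 0 < v by lra.
    have l0 : 0 < ln v by exact: ln_gt0.
    have l20 : 0 < ln v / 2 by lra.
    have [s [H As]] := filter_ex (filterI (unif _ l20) FA).
    have [_ s1 _] := Aw s As.
    have : v <= expR (ln v / 2) * 1.
      apply: (@le_trans _ _ (expR (ln v / 2)
        * (expR ((logder o s x + logder o s y) / 2) * o x y))); last first.
        by apply: ler_wpM2l; [exact: expR_ge0|exact: s1].
      rewrite mulrA -expRD /v; apply: ler_wpM2r; first exact: moebius_fun_ge0.
      rewrite ler_expR -/v; have := H x; have := H y; rewrite !ler_norml; lra.
    by rewrite mulr1 -{1}[v]lnK ?posrE// ler_expR; lra.
  - have [s [H As]] := filter_ex (filterI (unif _ e0) FA).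
    have [y sy] := moebius_fun_opposite s x; exists y.
    rewrite -[leLHS]mulr1 -[X in _ * X <= _]sy (moebius_fun_logder o).
    rewrite mulrA -expRD.
    apply: ler_wpM2r; first exact: moebius_fun_ge0.
    rewrite ler_expR; have := H x; have := H y; rewrite !ler_norml; lra.
have [r rf] := log_weight_realized wf.
have near_r e : 0 < e -> F [set s | mdist r s <= e].
  move=> e0; apply: filterS (unif e e0) => s H.
  by apply: (@mdist_le_logder _ _ o) => x; rewrite rf.
exists r; split=> /=.
  apply/ler_addgt0Pr => e e0.
  have [s [H As]] := filter_ex (filterI (near_r e e0) FA).
  apply: le_trans (metric_triangle o s r) _.
  by rewrite (metric_sym s r); apply: lerD.
move=> W /nbhs_ballP[e /= e0 eW]; have e20 : 0 < e / 2 by lra.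
apply: filterS (near_r _ e20) => s /= H; apply: eW.
by rewrite ballEmdist /=; apply: le_lt_trans H _; lra.
Qed.

End properness.

(** * The kernel on the union of the Moebius space and its boundary *)

Lemma ratio_distl_le (R : realType) (a b c : R) :
  1 <= c -> a <= 1 -> b <= 1 -> a <= c * b -> b <= c * a -> `|a - b| <= c - 1.
Proof.
move=> c1 a1 b1 ab ba; have c0 : 0 <= c - 1 by rewrite subr_ge0.
have := ler_wpM2l c0 a1; have := ler_wpM2l c0 b1; rewrite ler_norml; lra.
Qed.

Section pairing.
Context {R : realType} {Z : antipodalSpace R}.
Local Notation M := (moebius_space Z).
Implicit Types (o r s : M) (x y xi eta : Z) (w v : Z -> R).

Definition weight w := (forall x, 0 <= w x <= 1) /\ exists x, w x = 1.

(** The expression that computes distances in [mdist_attained], for weights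
    normalized to have maximum 1. *)
Definition pairing o w v : R :=
  sup (range (fun p : Z * Z => w p.1 * v p.2 * o p.1 p.2)).

Lemma pairing_le o w v c :
  (forall x y, w x * v y * o x y <= c) -> pairing o w v <= c.
Proof.
move=> H; apply: ge_sup; last by move=> _ [[x y] _ <-]; exact: H.
have [x _] := @antipodal_nonempty R Z.
by exists (w x * v x * o x x), (x, x).
Qed.

Let mul_le1 (a b : R) : 0 <= a <= 1 -> 0 <= b <= 1 -> 0 <= a * b <= 1.
Proof.
by move=> /andP[a0 a1] /andP[b0 b1]; rewrite mulr_ge0//= mulr_ile1.
Qed.

Let term_le1 o w v x y :
  weight w -> weight v -> 0 <= w x * v y * o x y <= 1.
Proof.
move=> [w01 _] [v01 _]; apply: mul_le1; first exact: mul_le1.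
by rewrite moebius_fun_ge0 moebius_fun_le1.
Qed.

Lemma pairing_ge o w v x y :
  weight w -> weight v -> w x * v y * o x y <= pairing o w v.
Proof.
move=> Ww Wv; apply: ub_le_sup; last by exists (x, y).
by exists 1 => _ [[x' y'] _ <-]; have /andP[] := term_le1 o x' y' Ww Wv.
Qed.

Lemma pairing_ge0 o w v : weight w -> weight v -> 0 <= pairing o w v.
Proof.
move=> Ww Wv; have [x _] := @antipodal_nonempty R Z.
apply: le_trans (pairing_ge o x x Ww Wv).
by have /andP[] := term_le1 o x x Ww Wv.
Qed.

Lemma pairing_le1 o w v : weight w -> weight v -> pairing o w v <= 1.
Proof.
by move=> Ww Wv; apply: pairing_le => x y;
  have /andP[] := term_le1 o x y Ww Wv.
Qed.

Lemma pairing_sym o w v : weight w -> weight v -> pairing o w v = pairing o v w.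
Proof.
have aux u u' : weight u -> weight u' -> pairing o u u' <= pairing o u' u.
  move=> Wu Wu'; apply: pairing_le => x y.
  by rewrite moebius_fun_sym [u x * _]mulrC; exact: pairing_ge.
by move=> Ww Wv; apply/eqP; rewrite eq_le !aux.
Qed.

Definition point_weight xi x : R := (x == xi)%:R.

Lemma point_weightP xi : weight (point_weight xi).
Proof.
split=> [x|]; last by exists xi; rewrite /point_weight eqxx.
by rewrite /point_weight; case: eqP; rewrite ?lexx ?ler01.
Qed.

Lemma pairing_point_ge o xi v y :
  weight v -> v y * o xi y <= pairing o (point_weight xi) v.
Proof.
move=> Wv; have := pairing_ge o xi y (point_weightP xi) Wv.
by rewrite /point_weight eqxx mul1r.
Qed.

Lemma pairing_point_le o xi v c : 0 <= c ->
  (forall y, v y * o xi y <= c) -> pairing o (point_weight xi) v <= c.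
Proof.
move=> c0 H; apply: pairing_le => x y; rewrite /point_weight.
by case: eqP => [->|_]; rewrite ?mul1r ?mul0r.
Qed.

Lemma pairing_points o xi eta :
  pairing o (point_weight xi) (point_weight eta) = o xi eta.
Proof.
apply/eqP; rewrite eq_le; apply/andP; split.
  apply: pairing_point_le; first exact: moebius_fun_ge0.
  move=> y; rewrite /point_weight.
  by case: eqP => [->|_]; rewrite ?mul1r ?mul0r ?moebius_fun_ge0.
have := pairing_point_ge o xi eta (point_weightP eta).
by rewrite /point_weight eqxx mul1r.
Qed.

(** A weight with a small pairing with [xi] is small away from [xi], and
    reaches 1 near [xi]; so it may be replaced by the point weight at [xi] in
    any pairing, with an error controlled by the uniform continuity of [o]
    alone and not by the other weight. *)
Lemma pairing_near_point o xi (e : R) : 0 < e ->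
  exists2 d, 0 < d & forall w v, weight w -> weight v ->
    pairing o (point_weight xi) w <= d ->
    `|pairing o w v - pairing o (point_weight xi) v| <= e.
Proof.
move=> e0.
have [d0 d00 d0P] := moebius_fun_nbhs o (moebius_fun_uniform o xi e0).
pose d := Num.min (d0 / 2) (e * d0).
have d_gt0 : 0 < d by rewrite lt_min divr_gt0 ?mulr_gt0.
have dd0 : d < d0 by apply: (@le_lt_trans _ _ (d0 / 2));
  [rewrite ge_min lexx|lra].
have de : d <= e * d0 by rewrite ge_min lexx orbT.
exists d => // w v Ww Wv wd; have [w01 [x0 wx0]] := Ww; have [v01 _] := Wv.
have wo x : w x * o xi x <= d by apply: le_trans wd; exact: pairing_point_ge.
have H1 : pairing o w v <= pairing o (point_weight xi) v + e.
  apply: pairing_le => x y.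
  have /andP[vy0 vy1] := v01 y; have /andP[wx0' wx1] := w01 x.
  have [xd|xd] := ltP (o xi x) d0.
    have := d0P x xd y; rewrite ler_norml => /andP[H _].
    apply: (@le_trans _ _ (v y * (o xi y + e))).
      apply: (@le_trans _ _ (v y * o x y)).
        by rewrite -mulrA ler_piMl ?mulr_ge0 ?moebius_fun_ge0.
      by apply: ler_wpM2l => //; lra.
    rewrite mulrDr; apply: lerD; first exact: pairing_point_ge.
    by rewrite -[leRHS]mul1r ler_wpM2r// ltW.
  have we : w x <= e.
    rewrite -(ler_pM2r d00); apply: le_trans de; apply: le_trans (wo x).
    by apply: ler_wpM2l.
  apply: (@le_trans _ _ e); last first.
    by rewrite lerDr; apply: pairing_ge0 => //; exact: point_weightP.
  apply: le_trans we; rewrite -mulrA -[leRHS]mulr1; apply: ler_wpM2l => //.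
  by rewrite mulr_ile1 ?moebius_fun_ge0 ?moebius_fun_le1.
have H2 : pairing o (point_weight xi) v <= pairing o w v + e.
  have ox0 : o xi x0 < d0.
    by apply: le_lt_trans dd0; have := wo x0; rewrite wx0 mul1r.
  apply: pairing_point_le => [|y]; first by rewrite addr_ge0 ?pairing_ge0// ltW.
  have /andP[vy0 vy1] := v01 y.
  have := d0P x0 ox0 y; rewrite ler_norml => /andP[_ H].
  apply: (@le_trans _ _ (v y * (o x0 y + e))).
    by apply: ler_wpM2l => //; lra.
  rewrite mulrDr; apply: lerD.
    by have := pairing_ge o x0 y Ww Wv; rewrite wx0 mul1r.
  by rewrite -[leRHS]mul1r ler_wpM2r// ltW.
rewrite ler_norml; lra.
Qed.

Definition space_weight o r x : R := expR ((logder o r x - mdist o r) / 2).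

Lemma space_weightP o r : weight (space_weight o r).
Proof.
split=> [x|].
  rewrite expR_ge0/= -[leRHS]expR0 ler_expR; have := logder_le o r x; lra.
have [x xP] := logder_max o r; exists x.
by rewrite /space_weight xP subrr mul0r expR0.
Qed.

Lemma pairing_space o r s :
  pairing o (space_weight o r) (space_weight o s)
    = expR (- gromov_product o r s).
Proof.
have E x y : space_weight o r x * space_weight o s y * o x y =
    expR (- ((mdist o r + mdist o s) / 2))
      * (expR ((logder o r x + logder o s y) / 2) * o x y).
  rewrite /space_weight -expRD mulrA -expRD; congr (expR _ * _); lra.
have -> : expR (- gromov_product o r s) =
    expR (- ((mdist o r + mdist o s) / 2)) * expR (mdist r s / 2).
  rewrite -expRD; congr expR; rewrite /gromov_product; lra.
apply/eqP; rewrite eq_le; apply/andP; split.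
  apply: pairing_le => x y; rewrite E.
  by rewrite ler_pM2l ?expR_gt0// mdist_ge_pair.
have [x [y <-]] := mdist_attained o r s; rewrite -E.
by apply: pairing_ge; exact: space_weightP.
Qed.

Lemma pairing_point_space o xi r :
  pairing o (point_weight xi) (space_weight o r)
    <= expR (- ((mdist o r + logder o r xi) / 2)).
Proof.
apply: pairing_point_le; first exact: expR_ge0.
move=> y; have := moebius_fun_le1 r xi y; rewrite (moebius_fun_logder o) => H.
rewrite -[leRHS]mulr1.
have -> : space_weight o r y = expR (- ((mdist o r + logder o r xi) / 2))
    * expR ((logder o r xi + logder o r y) / 2).
  rewrite /space_weight -expRD; congr expR; lra.
by rewrite -mulrA ler_pM2l ?expR_gt0.
Qed.

Lemma space_weight_lipschitz o r s x :
  space_weight o r x <= expR (mdist r s) * space_weight o s x.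
Proof.
rewrite /space_weight -expRD ler_expR.
have := logder_dist_le o r s x; rewrite ler_norml.
have := metric_triangle o r s; lra.
Qed.

Lemma pairing_space_le o r s v : weight v ->
  pairing o (space_weight o r) v
    <= expR (mdist r s) * pairing o (space_weight o s) v.
Proof.
move=> Wv; apply: pairing_le => x y.
have [v01 _] := Wv; have /andP[v0 _] := v01 y.
apply: (@le_trans _ _ (expR (mdist r s) * (space_weight o s x * v y * o x y))).
  rewrite !mulrA; apply: ler_wpM2r; first exact: moebius_fun_ge0.
  by apply: ler_wpM2r; [exact: v0|exact: space_weight_lipschitz].
rewrite ler_pM2l ?expR_gt0//.
by apply: pairing_ge; [exact: space_weightP|exact: Wv].
Qed.

Lemma pairing_space_lipschitz o r s v : weight v ->
  `|pairing o (space_weight o r) v - pairing o (space_weight o s) v|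
    <= expR (mdist r s) - 1.
Proof.
move=> Wv; have e1 : 1 <= expR (mdist r s).
  by rewrite -[leLHS]expR0 ler_expR mdist_ge0.
have srE : pairing o (space_weight o s) v
    <= expR (mdist r s) * pairing o (space_weight o r) v.
  by rewrite metric_sym; exact: pairing_space_le.
exact: (ratio_distl_le e1 (pairing_le1 o (space_weightP o r) Wv)
  (pairing_le1 o (space_weightP o s) Wv) (pairing_space_le o r s Wv) srE).
Qed.

(** The weight of a point [xi] of [Z] is the pointwise limit of the weights
    along a ray from [o] to [xi]. *)
Definition hat_weight o (p : M + Z) : Z -> R :=
  match p with inl r => space_weight o r | inr xi => point_weight xi end.

(** Extends both [exp (- gromov_product o)] and [o]. *)
Definition hat_kernel o (p q : M + Z) : R :=
  pairing o (hat_weight o p) (hat_weight o q).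

Lemma hat_weightP o p : weight (hat_weight o p).
Proof. by case: p => [r|xi]; [exact: space_weightP|exact: point_weightP]. Qed.

Lemma hat_kernel_ge0 o p q : 0 <= hat_kernel o p q.
Proof. by apply: pairing_ge0; exact: hat_weightP. Qed.

Lemma hat_kernel_le1 o p q : hat_kernel o p q <= 1.
Proof. by apply: pairing_le1; exact: hat_weightP. Qed.

Lemma hat_kernel_sym o p q : hat_kernel o p q = hat_kernel o q p.
Proof. by apply: pairing_sym; exact: hat_weightP. Qed.

Lemma hat_kernel_spaces o r s :
  hat_kernel o (inl r) (inl s) = expR (- gromov_product o r s).
Proof. exact: pairing_space. Qed.

Lemma hat_kernel_points o xi eta : hat_kernel o (inr xi) (inr eta) = o xi eta.
Proof. exact: pairing_points. Qed.

Lemma hat_kernel_near o xi (e : R) : 0 < e ->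
  exists2 d, 0 < d & forall p q, hat_kernel o (inr xi) p <= d ->
    `|hat_kernel o p q - hat_kernel o (inr xi) q| <= e.
Proof.
move=> /(pairing_near_point o xi)[d d0 H]; exists d => // p q.
by apply: H; exact: hat_weightP.
Qed.

Lemma hat_kernel_space_near o r (e : R) : 0 < e ->
  exists2 d, 0 < d & forall s, mdist r s < d -> forall q,
    `|hat_kernel o (inl s) q - hat_kernel o (inl r) q| <= e.
Proof.
move=> e0; exists (ln (1 + e)) => [|s rs q]; first by rewrite ln_gt0// ltrDl.
apply: le_trans (pairing_space_lipschitz o s r (hat_weightP o q)) _.
rewrite lerBlDl -[leRHS]lnK ?posrE ?addr_gt0// ler_expR metric_sym.
exact: ltW.
Qed.

Lemma hat_kernel_base o s p q :
  hat_kernel o p q <= expR (3 * mdist o s) * hat_kernel s p q.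
Proof.
have W p' x : hat_weight o p' x <= expR (mdist o s) * hat_weight s p' x.
  case: p' => [r|xi] /=.
    rewrite /space_weight -expRD ler_expR (logder_cocycle s o r).
    have := logder_le o s x; have := metric_triangle s o r.
    rewrite (metric_sym s o); lra.
  rewrite -[leLHS]mul1r; apply: ler_wpM2r.
    by have [/(_ x)/andP[]] := point_weightP xi.
  by rewrite -[leLHS]expR0 ler_expR mdist_ge0.
apply: pairing_le => x y.
apply: (@le_trans _ _ (expR (3 * mdist o s)
    * (hat_weight s p x * hat_weight s q y * s x y))); last first.
  by rewrite ler_pM2l ?expR_gt0//; apply: pairing_ge; exact: hat_weightP.
have oE : o x y <= expR (mdist o s) * s x y.
  rewrite (moebius_fun_logder s o); apply: ler_wpM2r.
    exact: moebius_fun_ge0.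
  rewrite ler_expR metric_sym.
  have := logder_le s o x; have := logder_le s o y; lra.
have [p01 _] := hat_weightP o p; have /andP[p0 _] := p01 x.
have [q01 _] := hat_weightP o q; have /andP[q0 _] := q01 y.
have -> : 3 * mdist o s = mdist o s + mdist o s + mdist o s by lra.
rewrite !expRD.
have -> : forall a b c d : R,
    a * a * a * (b * c * d) = a * b * (a * c) * (a * d) by move=> *; ring.
apply: ler_pM; rewrite ?mulr_ge0 ?moebius_fun_ge0//.
by apply: ler_pM.
Qed.

End pairing.

(** * Quasi-metrics and hyperbolicity *)

Lemma expR_max_min (R : realType) (u v w d : R) :
  Num.min v w - d <= u ->
  expR (- u) <= expR d * Num.max (expR (- v)) (expR (- w)).
Proof.
rewrite /Num.min; case: ifP => _ H; rewrite maxr_pMr ?expR_ge0// le_max;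
  rewrite -!expRD !ler_expR; apply/orP; [left|right]; lra.
Qed.

Lemma expR_half_swap (R : realType) (a b c d : R) :
  expR ((a + b) / 2) * expR ((c + d) / 2)
    = expR ((a + c) / 2) * expR ((b + d) / 2).
Proof. by rewrite -!expRD; congr expR; lra. Qed.

Lemma approx_max (R : realType) (C h k1 k2 k3 u v w : R) : 0 <= C ->
  `|u - k1| <= h -> `|v - k2| <= h -> `|w - k3| <= h ->
  u <= C * Num.max v w -> k1 <= C * Num.max k2 k3 + (h + C * h).
Proof.
move=> C0; rewrite !ler_norml => H1 H2 H3 H.
have Hm : Num.max v w <= Num.max k2 k3 + h.
  rewrite ge_max; apply/andP; split.
    apply: (@le_trans _ _ (k2 + h)); last by rewrite lerD2r le_max lexx.
    lra.
  apply: (@le_trans _ _ (k3 + h)); last by rewrite lerD2r le_max lexx orbT.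
  lra.
have := ler_wpM2l C0 Hm; lra.
Qed.

Section hyperbolicity.
Context {R : realType} {Z : antipodalSpace R}.
Local Notation M := (moebius_space Z).
Implicit Types (o r s : M) (x y z xi : Z) (p q : M + Z).

(** Comparing with the smallest of the four distances on the right-hand side
    bounds both distances on the left-hand side by the two factors of the
    product that does not involve it. *)
Lemma quasi_metric_four_points (rho : Z -> Z -> R) (K : R) x y z w :
  1 <= K -> (forall a b, 0 <= rho a b) -> (forall a b, rho a b = rho b a) ->
  (forall a b c, rho a b <= K * Num.max (rho a c) (rho c b)) ->
  rho x y * rho z w
    <= K ^+ 2 * Num.max (rho x z * rho y w) (rho x w * rho y z).
Proof.
move=> K1 r0 rs rK; have K0 : 0 <= K by lra.
have small a b c : rho a c <= rho c b -> rho a b <= K * rho c b.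
  by move=> H; apply: le_trans (rK a b c) _; rewrite max_r.
have aux a b c d : rho a c <= rho c b -> rho a c <= rho a d ->
    rho a b * rho c d <= K ^+ 2 * (rho a d * rho b c).
  move=> H1 H2; have -> : K ^+ 2 * (rho a d * rho b c)
      = (K * rho c b) * (K * rho a d) by rewrite (rs b c); ring.
  by apply: ler_pM => //; apply: small => //; rewrite rs.
have := aux x y z w; have := aux x y w z.
have := aux y x z w; have := aux y x w z.
rewrite ?(rs z x) ?(rs z y) ?(rs w x) ?(rs w y) (rs y x) (rs w z).
rewrite ![rho y w * rho x z]mulrC ![rho y z * rho x w]mulrC.
rewrite maxr_pMr ?sqr_ge0// le_max => yw yz xw xz; apply/orP.
case: (leP (rho x z) (rho x w)) => H1; case: (leP (rho y z) (rho y w)) => H2.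
- by case: (leP (rho x z) (rho y z)) => H3; [right; apply: xz|
    left; apply: yz => //; exact: ltW].
- by case: (leP (rho x z) (rho y w)) => H3; right;
    [apply: xz => //; apply: le_trans H3 (ltW H2)|
     apply: yw; [exact: le_trans (ltW H3) H1|exact: ltW]].
- by case: (leP (rho x w) (rho y z)) => H3; left;
    [apply: xw; [exact: le_trans H3 H2|exact: ltW]|
     apply: yz => //; exact: le_trans (ltW H3) (ltW H1)].
- by case: (leP (rho x w) (rho y w)) => H3; [left; apply: xw => //; exact: ltW|
    right; apply: yw; exact: ltW].
Qed.

(** The distances of the Moebius space are suprema of weighted logarithms of
    [o], so that a four-point inequality for [o] passes to them. *)
Lemma quasi_metric_moebius_hyperbolic o :
  quasi_metric o -> gromov_hyperbolic (moebius_space Z).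
Proof.
move=> [K K1 oK]; have K0 : 0 < K by lra.
have lK : 0 <= ln K by exact: ln_ge0.
exists (2 * ln K) => [|a b c r]; first by lra.
suff : mdist a b + mdist c r <=
    Num.max (mdist a c + mdist b r) (mdist a r + mdist b c) + 4 * ln K.
  rewrite /gromov_product lerBlDr ge_min /Num.max.
  rewrite (metric_sym r a) (metric_sym r c) (metric_sym r b) (metric_sym c b).
  by case: ifP => _ H; apply/orP; [right|left]; lra.
have KE : K ^+ 2 = expR ((4 * ln K) / 2).
  have -> : 4 * ln K / 2 = ln K + ln K by lra.
  by rewrite expRD lnK ?posrE// expr2.
have [x [y xyE]] := mdist_attained o a b.
have [z [w zwE]] := mdist_attained o c r.
have := quasi_metric_four_points x y z w K1 (moebius_fun_ge0 o)
  (moebius_fun_sym o) oK.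
pose L := expR ((logder o a x + logder o b y) / 2)
          * expR ((logder o c z + logder o r w) / 2).
have L0 : 0 < L by rewrite mulr_gt0 ?expR_gt0.
rewrite -(ler_pM2l L0).
have -> : L * (o x y * o z w) = expR ((mdist a b + mdist c r) / 2).
  by rewrite mulrDl expRD -xyE -zwE /L; ring.
have bound a' b' c' r' x' y' z' w' :
    L = expR ((logder o a' x' + logder o b' y') / 2)
        * expR ((logder o c' z' + logder o r' w') / 2) ->
    L * (K ^+ 2 * (o x' y' * o z' w')) <=
      expR ((mdist a' b' + mdist c' r' + 4 * ln K) / 2).
  move=> LE; rewrite mulrDl expRD -KE mulrDl expRD LE.
  rewrite [leLHS]mulrCA [leRHS]mulrC ler_pM2l ?exprn_gt0// mulrACA.
  apply: ler_pM; rewrite ?mulr_ge0 ?expR_ge0 ?moebius_fun_ge0//;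
    exact: mdist_ge_pair.
have fin m : expR ((mdist a b + mdist c r) / 2) <= expR ((m + 4 * ln K) / 2) ->
    mdist a b + mdist c r - 4 * ln K <= m.
  by rewrite ler_expR; clear; lra.
move=> H; rewrite -lerBlDr le_max; apply/orP.
rewrite /Num.max in H; case: ifP H => _ /le_trans H.
  right; apply: fin; apply: H; apply: bound.
  by rewrite /L [logder o c z + _]addrC; exact: expR_half_swap.
left; apply: fin; apply: H; apply: bound.
exact: expR_half_swap.
Qed.

Lemma hat_kernel_dense o p (e : R) : 0 < e ->
  exists r : M, forall q, `|hat_kernel o (inl r) q - hat_kernel o p q| <= e.
Proof.
move=> e0; case: p => [r|xi]; first by exists r => q; rewrite subrr normr0 ltW.
have [d d0 dP] := hat_kernel_near o xi e0.
have [g [_ _ gxi]] := moebius_ray_exists o xi.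
pose t := Num.max 0 (- ln d); exists (g t) => q.
have t0 : 0 <= t by rewrite le_max lexx.
apply: dP; apply: le_trans (pairing_point_space _ _ _) _.
rewrite gxi// -[leRHS]lnK ?posrE// ler_expR.
have : - ln d <= t by rewrite le_max lexx orbT.
have := logder_le o (g t) xi; rewrite gxi//; lra.
Qed.

(** Hyperbolicity is an ultrametric inequality up to a factor for the kernel
    on the Moebius space, which extends to points of [Z] by density. *)
Lemma hat_kernel_hyperbolic : gromov_hyperbolic (moebius_space Z) ->
  exists2 K : R, 1 <= K & forall o p q m,
    hat_kernel o p q <= K * Num.max (hat_kernel o p m) (hat_kernel o m q).
Proof.
move=> [delta d0 hyp]; exists (expR delta).
  by rewrite -[leLHS]expR0 ler_expR.
move=> o p q m; apply/ler_addgt0Pr => e e0.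
set K := expR delta; have K1 : 1 <= K by rewrite -[leLHS]expR0 ler_expR.
pose h := e / (2 + 2 * K); have h0 : 0 < h by rewrite divr_gt0//; lra.
have hE : 2 * h + K * (2 * h) = e by rewrite /h; field; lra.
have [a aP] := hat_kernel_dense o p h0.
have [b bP] := hat_kernel_dense o q h0.
have [c cP] := hat_kernel_dense o m h0.
have close (u v : M + Z) (u' v' : M) :
    (forall w, `|hat_kernel o (inl u') w - hat_kernel o u w| <= h) ->
    (forall w, `|hat_kernel o (inl v') w - hat_kernel o v w| <= h) ->
    `|hat_kernel o (inl u') (inl v') - hat_kernel o u v| <= 2 * h.
  move=> /(_ (inl v')) H1 /(_ u).
  rewrite (hat_kernel_sym o (inl v')) (hat_kernel_sym o v) => H2.
  apply: le_trans (ler_distD (hat_kernel o u (inl v')) _ _) _.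
  by rewrite mulr_natl mulr2n lerD.
have K0 : 0 <= K by exact: expR_ge0.
rewrite -hE; apply: approx_max K0 (close _ _ _ _ aP bP) (close _ _ _ _ aP cP)
  (close _ _ _ _ cP bP) _.
by rewrite !hat_kernel_spaces; apply: expR_max_min; exact: hyp.
Qed.

Lemma moebius_hyperbolic_quasi_metric o :
  gromov_hyperbolic (moebius_space Z) -> quasi_metric o.
Proof.
move=> /hat_kernel_hyperbolic[K K1 H]; exists K => // x y z.
by have := H o (inr x) (inr y) (inr z); rewrite !hat_kernel_points.
Qed.

End hyperbolicity.

(** * Ends of geodesic rays *)

Section ends.
Context {R : realType} {Z : antipodalSpace R}.
Local Notation M := (moebius_space Z).
Implicit Types (o r s : M) (x y z : Z) (p q : M + Z) (g h : R -> M).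

Definition ray_end g z := forall t, 0 <= t -> logder (g 0) (g t) z = t.

(** The sets where the logarithmic derivative of [g t] reaches its maximum
    [t] are nonempty, closed and decrease with [t], because it changes by at
    most [t - s] between the times [s] and [t]; a point in all of them exists
    by compactness. *)
Lemma ray_end_exists g : geodesic_ray g -> exists z, ray_end g z.
Proof.
move=> gg; have gd (t : R) : 0 <= t -> mdist (g 0) (g t) = t.
  by move=> t0; rewrite gg// sub0r normrN ger0_norm.
have /choice[m mP] (t : R) : exists x, 0 <= t -> logder (g 0) (g t) x = t.
  have [x xP] := logder_max (g 0) (g t); exists x => t0.
  by rewrite xP gd.
have mono (s t : R) : 0 <= s -> s <= t -> logder (g 0) (g s) (m t) = s.
  move=> s0 st; have t0 := le_trans s0 st; apply/eqP; rewrite eq_le.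
  have := logder_le (g 0) (g s) (m t); rewrite gd// => -> /=.
  have := logder_dist_le (g 0) (g s) (g t) (m t).
  rewrite mP// gg// distrC [`|s - t|]distrC [X in _ <= X]ger0_norm ?subr_ge0//.
  by rewrite ler_norml => /andP[_ H]; lra.
have [z [_ clz]] := @antipodal_compact R Z (m @ +oo%R) _ filterT.
exists z => s s0; apply/eqP; apply/negPn/negP => ne.
pose e := `|logder (g 0) (g s) z - s|.
have e0 : 0 < e by rewrite normr_gt0 subr_eq0.
have := @cvgr_dist_lt _ _ _ _ _ _ _ (@logder_continuous R Z (g 0) (g s) z) e e0.
move=> near_z; have near_m : (m @ +oo%R) [set x | logder (g 0) (g s) x = s].
  exists s; split; first exact: num_real.
  by move=> t st; apply: mono => //; exact: ltW.
have [x [/= xs]] := clz _ _ near_m (near_z _).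
by rewrite xs ltxx.
Qed.

Lemma hat_kernel_ray_end o g z (t : R) : ray_end g z -> 0 <= t ->
  hat_kernel o (inr z) (inl (g t)) <= expR (mdist o (g 0) - t).
Proof.
move=> gz t0; apply: le_trans (pairing_point_space _ _ _) _; rewrite ler_expR.
have := gz t t0; rewrite (logderB o) => E.
have := normr_logder_le o (g 0) z; have := logder_le o (g t) z.
rewrite ler_norml; lra.
Qed.

Lemma near_pinfty_ge_expR (D d : R) : 0 < d ->
  \forall t \near +oo, 0 <= t /\ expR (D - t) <= d.
Proof.
move=> d0; near=> t; split.
  by near: t; apply: nbhs_pinfty_ge; exact: num_real.
rewrite -[leRHS]lnK ?posrE// ler_expR lerBlDr -lerBlDl.
by near: t; apply: nbhs_pinfty_ge; exact: num_real.
Unshelve. all: by end_near. Qed.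

Lemma hat_kernel_ray_cvg o g z (e : R) : ray_end g z -> 0 < e ->
  \forall t \near +oo, forall q,
    `|hat_kernel o (inl (g t)) q - hat_kernel o (inr z) q| <= e.
Proof.
move=> gz e0; have [d d0 dP] := hat_kernel_near o z e0.
apply: filterS (near_pinfty_ge_expR (mdist o (g 0)) d0) => t [t0 td] q.
by apply: dP; apply: le_trans td; exact: hat_kernel_ray_end.
Qed.

(** If [g t] and [h t] stay close, the logarithmic derivative of [g t] is
    nearly [t] at both ends, which for large [t] is impossible at two distinct
    points because [g t] does not exceed 1. *)
Lemma asymptotic_end g h y z :
  ray_end g y -> ray_end h z -> asymptotic g h -> y = z.
Proof.
move=> gy hz [C gh]; apply/eqP/negPn/negP => yz.
have oyz : 0 < (g 0 : M) y z by rewrite moebius_fun_gt0.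
pose D := (C + mdist (g 0) (h 0)) / 2.
have oy2 : 0 < (g 0 : M) y z / 2 by rewrite divr_gt0.
have [t [t0]] := filter_ex (near_pinfty_ge_expR D oy2).
have [_ H _] := logder_log_weight (g 0) (g t).
have {H} := H y z; rewrite gy// => H.
have Hz : t - D *+ 2 <= logder (g 0) (g t) z.
  have := logder_dist_le (g 0) (g t) (h t) z.
  have := hz t t0; rewrite (logderB (g 0)).
  have := normr_logder_le (g 0) (h 0) z; have := gh t t0.
  rewrite !ler_norml mulr2n /D; lra.
have : (g 0 : M) y z <= expR (D - t).
  rewrite -(ler_pM2l (expR_gt0 (t - D))) -expRD.
  have -> : t - D + (D - t) = 0 by lra.
  rewrite expR0; apply: le_trans H.
  apply: ler_wpM2r; first exact: moebius_fun_ge0.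
  by rewrite ler_expR; rewrite mulr2n in Hz; lra.
by move=> H1 H2; have := le_trans H1 H2; lra.
Qed.

Hypothesis hyp : gromov_hyperbolic (moebius_space Z).

(** Two rays with the same end are both close to it for the kernel, hence
    close to each other by the ultrametric inequality, with a Gromov product
    that differs from [t] by a bounded amount. *)
Lemma ray_end_asymptotic g h z : geodesic_ray g -> geodesic_ray h ->
  ray_end g z -> ray_end h z -> asymptotic g h.
Proof.
move=> gg gh gz hz; have [K K1 KP] := hat_kernel_hyperbolic hyp.
have K0 : 0 < K by lra.
pose o := g 0; pose D := mdist o (h 0).
exists (3 * D + 2 * ln K) => t t0.
have H : hat_kernel o (inl (g t)) (inl (h t)) <= expR (ln K + (D - t)).
  apply: le_trans (KP _ _ _ (inr z)) _.
  rewrite expRD lnK ?posrE// ler_pM2l// ge_max; apply/andP; split.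
    rewrite hat_kernel_sym; apply: le_trans (hat_kernel_ray_end o gz t0) _.
    by rewrite ler_expR /o mdistxx lerD2r mdist_ge0.
  exact: (hat_kernel_ray_end o hz t0).
move: H; rewrite hat_kernel_spaces ler_expR /gromov_product.
have := gg 0 t (lexx 0) t0; have := gh 0 t (lexx 0) t0.
rewrite sub0r normrN ger0_norm//.
have := metric_triangle o (h 0) (h t); rewrite -/o -/D; lra.
Qed.

Lemma visual_boundary_ray (xi : visual_boundary (moebius_space Z)) :
  exists g, boundary_class xi g.
Proof.
have [g gg E] := boundary_classP xi; exists g; rewrite E; split=> //.
by exists 0 => t _; rewrite mdistxx.
Qed.

Lemma visual_boundary_geodesic (xi : visual_boundary (moebius_space Z)) g :
  boundary_class xi g -> geodesic_ray g.
Proof. by have [h _ ->] := boundary_classP xi; case. Qed.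

Lemma visual_boundary_asymptotic (xi : visual_boundary (moebius_space Z)) g h :
  boundary_class xi g -> geodesic_ray h ->
  boundary_class xi h <-> asymptotic g h.
Proof.
have [k _ ->] := boundary_classP xi => -[gg [C kg]] gh; split.
  move=> [_ [D kh]]; exists (C + D) => t t0.
  apply: le_trans (metric_triangle _ (k t) _) _; rewrite metric_sym.
  by apply: lerD; [exact: kg|exact: kh].
move=> [D gh']; split=> //; exists (C + D) => t t0.
apply: le_trans (metric_triangle _ (g t) _) _.
by apply: lerD; [exact: kg|exact: gh'].
Qed.

Lemma visual_boundary_eq (xi eta : visual_boundary (moebius_space Z)) :
  boundary_class xi = boundary_class eta -> xi = eta.
Proof.
case: xi eta => [A a] [B b] /= E; rewrite E in a *.
by rewrite (Prop_irrelevance a b).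
Qed.

Lemma boundary_end_exists (xi : visual_boundary (moebius_space Z)) :
  exists z, forall g, boundary_class xi g -> ray_end g z.
Proof.
have [g xig] := visual_boundary_ray xi.
have [z gz] := ray_end_exists (visual_boundary_geodesic xig).
exists z => h xih; have gh := visual_boundary_geodesic xih.
have [y hy] := ray_end_exists gh.
rewrite (@asymptotic_end g h z y)//.
exact/(visual_boundary_asymptotic xig).
Qed.

Definition boundary_end (xi : visual_boundary (moebius_space Z)) : Z :=
  sval (cid (boundary_end_exists xi)).

Lemma boundary_endP (xi : visual_boundary (moebius_space Z)) g :
  boundary_class xi g -> ray_end g (boundary_end xi).
Proof. by rewrite /boundary_end; case: cid => z /= H; exact: H. Qed.

Lemma boundary_end_ray (xi : visual_boundary (moebius_space Z)) g :
  geodesic_ray g -> ray_end g (boundary_end xi) -> boundary_class xi g.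
Proof.
move=> gg gz; have [h xih] := visual_boundary_ray xi.
apply/(visual_boundary_asymptotic xih gg).
exact: (ray_end_asymptotic (visual_boundary_geodesic xih) gg
  (boundary_endP xih) gz).
Qed.

Lemma boundary_ray_from (xi : visual_boundary (moebius_space Z)) o :
  exists g, boundary_class xi g /\ g 0 = o.
Proof.
have [g [gg g0 gz]] := moebius_ray_exists o (boundary_end xi).
exists g; split=> //; apply: boundary_end_ray => // t t0.
by rewrite g0; exact: gz.
Qed.

Lemma boundary_end_inj : injective boundary_end.
Proof.
move=> xi eta E; apply: visual_boundary_eq; apply/seteqP; split=> g H.
  apply: boundary_end_ray; first exact: (visual_boundary_geodesic H).
  by rewrite -E; exact: boundary_endP.
apply: boundary_end_ray; first exact: (visual_boundary_geodesic H).
by rewrite E; exact: boundary_endP.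
Qed.

Lemma boundary_end_surj z : exists xi, boundary_end xi = z.
Proof.
have [g [gg g0 gz]] := moebius_ray_exists (moebius_basepoint : M) z.
pose A := [set h | geodesic_ray h /\ asymptotic g h].
have AP : exists2 g, geodesic_ray g &
    A = [set h | geodesic_ray h /\ asymptotic g h] by exists g.
exists (VisualBoundary AP).
have Ag : boundary_class (VisualBoundary AP) g.
  by split=> //; exists 0 => t _; rewrite mdistxx.
apply: (@asymptotic_end g g _ _ (boundary_endP Ag)).
  by move=> t t0; rewrite g0; exact: gz.
by exists 0 => t _; rewrite mdistxx.
Qed.

End ends.

(** * Lower limits and extended logarithms *)

Section limits.
Context {R : realType}.

Lemma limf_einf_ge (f : R -> R) (r : R) :
  (\forall t \near +oo, r <= f t) ->
  (r%:E <= limf_einf (fun t => (f t)%:E) (+oo%R : set_system R))%E.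
Proof.
move=> H; rewrite limf_einfE; apply: ereal_sup_ge.
exists (ereal_inf [set (f t)%:E | t in [set t | r <= f t]]).
  by exists [set t | r <= f t].
by apply: le_ereal_inf_tmp => _ [t rt <-]; rewrite lee_fin.
Qed.

Lemma limf_einf_near (f : R -> R) (r s : R) :
  (r%:E <= limf_einf (fun t => (f t)%:E) (+oo%R : set_system R))%E ->
  s < r -> \forall t \near +oo, s <= f t.
Proof.
rewrite limf_einfE => H sr.
have sr' : (s%:E < r%:E)%E by rewrite lte_fin.
have [_ [V FV <-] sV] := ereal_sup_gt (lt_le_trans sr' H).
apply: filterS FV => t Vt.
rewrite -lee_fin; apply: le_trans (ltW sV) _.
by apply: ereal_inf_lbound; exists t.
Qed.

Lemma lne_continuous (a : R) :
  (fun u : R => lne u%:E) u @[u --> a] --> lne a%:E.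
Proof.
have [a0|a0] := ltP 0 a.
  have E : \forall u \near a, (ln u)%:E = lne u%:E.
    by apply: filterS (lt_nbhsr a0) => u u0; rewrite lne_EFin.
  rewrite lne_EFin//; apply: cvg_trans (near_eq_cvg E) _.
  by apply: cvg_EFin; [exact: nearW|exact: continuous_ln].
rewrite le0_lneNy ?lee_fin//; apply/cvgeNyPle => A.
have : a < expR A by exact: le_lt_trans a0 (expR_gt0 A).
move=> /lt_nbhsl; apply: filterS => u uA.
have [u0|u0] := ltP 0 u; last by rewrite le0_lneNy ?lee_fin// leNye.
by rewrite lne_EFin// lee_fin -[leRHS]expRK ler_ln ?posrE ?expR_gt0// ltW.
Qed.

End limits.

(** * The visual compactification *)

Lemma half_gap_gt0 (R : realType) (a b : R) : a < b -> 0 < (b - a) / 2.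
Proof. by move=> ab; rewrite divr_gt0// subr_gt0. Qed.

Lemma lt_of_half_gap (R : realType) (a b c : R) :
  a < b -> c <= a + (b - a) / 2 -> c < b.
Proof. lra. Qed.

Section compactification.
Context {R : realType} {Z : antipodalSpace R}.
Local Notation M := (moebius_space Z).
Local Notation B := (visual_boundary (moebius_space Z)).
Local Notation C := (visual_compactification (moebius_space Z)).
Implicit Types (o r s : M) (x y z : Z) (xi eta : B) (p q : C).

Hypothesis hyp : gromov_hyperbolic (moebius_space Z).

Definition to_hat p : M + Z :=
  match p with inl r => inl r | inr xi => inr (boundary_end xi) end.

Definition compact_kernel o p q := hat_kernel o (to_hat p) (to_hat q).

(** Along a ray from [o] the kernel converges to its value at the end, so the
    lower limit of Gromov products that defines a boundary neighbourhood is
    the value of the kernel at the boundary point. *)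
Lemma kernel_lt_boundary_nbhd o xi (r : R) p :
  hat_kernel o (inr (boundary_end xi)) (to_hat p) < expR (- r) ->
  boundary_nbhd o xi r p.
Proof.
move=> H; have [g [xig g0]] := boundary_ray_from hyp xi o.
have gz := boundary_endP xig.
exists g; split=> //.
have [e e0 eE] : exists2 e, 0 < e &
    hat_kernel o (inr (boundary_end xi)) (to_hat p) + e + e = expR (- r).
  exists ((expR (- r) - hat_kernel o (inr (boundary_end xi)) (to_hat p)) / 2).
    by rewrite divr_gt0// subr_gt0.
  by rewrite -addrA -splitr addrC subrK.
have ge := hat_kernel_ray_cvg o gz e0.
case: p {H} eE => [y|eta] /= eE.
  apply: (@limf_einf_ge _ (fun t => gromov_product o (g t) y)).
  apply: filterS ge => t /(_ (inl y)) /ler_distlDr.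
  rewrite hat_kernel_spaces => H1.
  rewrite -lerN2 -(@ler_expR R) -eE; apply: le_trans H1 _.
  by rewrite lerDl ltW.
have [h [etah h0]] := boundary_ray_from hyp eta o.
have hz := boundary_endP etah; exists h; split=> //.
apply: (@limf_einf_ge _ (fun t => gromov_product o (g t) (h t))).
apply: filterS (filterI ge (hat_kernel_ray_cvg o hz e0)).
move=> t [/(_ (inl (h t)))/ler_distlDr H1].
move=> /(_ (inr (boundary_end xi)))/ler_distlDr H2.
rewrite -lerN2 -(@ler_expR R) -hat_kernel_spaces -eE.
apply: le_trans H1 _; rewrite lerD2r hat_kernel_sym; apply: le_trans H2 _.
by rewrite hat_kernel_sym.
Qed.

Lemma boundary_nbhd_kernel_le o xi (r : R) p : boundary_nbhd o xi r p ->
  hat_kernel o (inr (boundary_end xi)) (to_hat p) <= expR (1 - r).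
Proof.
move=> [g [xig g0 P]]; have gz := boundary_endP xig.
apply/ler_addgt0Pr => e e0.
have e20 : 0 < e / 2 by rewrite divr_gt0.
have ge := hat_kernel_ray_cvg o gz e20.
have r1 : r - 1 < r by rewrite gtrBl.
have swap (a : R) : r - 1 <= a -> expR (- a) <= expR (1 - r).
  by rewrite ler_expR; lra.
case: p P => [y|eta] /= P.
  have Pn := @limf_einf_near _ (fun t => gromov_product o (g t) y) _ _ P r1.
  have [t [/(_ (inl y)) H1 /swap H2]] := filter_ex (filterI ge Pn).
  move: H1; rewrite distrC => /ler_distlDr /le_trans; apply.
  rewrite hat_kernel_spaces; apply: lerD => //.
  by rewrite ler_pdivrMr// ler_peMr ?ler1n// ltW.
have [h [etah h0 {}P]] := P; have hz := boundary_endP etah.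
have he := hat_kernel_ray_cvg o hz e20.
have Pn := @limf_einf_near _ (fun t => gromov_product o (g t) (h t)) _ _ P r1.
have [t [[H1 H2] /swap H3]] := filter_ex (filterI (filterI ge he) Pn).
have := H2 (inr (boundary_end xi)); rewrite distrC => /ler_distlDr {}H2.
have := H1 (inl (h t)); rewrite distrC => /ler_distlDr {}H1.
rewrite hat_kernel_sym; apply: le_trans H2 _.
rewrite [X in _ <= _ + X]splitr addrA lerD2r.
rewrite hat_kernel_sym; apply: le_trans H1 _; rewrite lerD2r.
by rewrite hat_kernel_spaces.
Qed.

Lemma nbhs_of_space r (e : R) : 0 < e ->
  nbhs (of_space r : C) [set p | exists2 s, p = of_space s & mdist r s < e].
Proof.
move=> e0; apply: open_nbhs_nbhs; split; last first.
  by exists r => //; rewrite mdistxx.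
split; last by move=> xi [].
have -> : (of_space (X := M)) @^-1`
    [set p | exists2 s, p = of_space s & mdist r s < e]
    = [set s | mdist r s < e].
  by apply/seteqP; split=> [s [s' [->]]|s rs]//; exists s.
rewrite openE => s /= rs; apply/nbhs_ballP; exists (e - mdist r s) => /=.
  by rewrite subr_gt0.
move=> s'; rewrite ballEmdist/= ltrBrDl; apply: le_lt_trans.
exact: metric_triangle.
Qed.

(** At another boundary point [eta] of this set, a boundary neighbourhood of
    [eta] consists of points whose kernel with [xi] is close to that of
    [eta]; it has to be found for every base point [x], and changing the base
    point costs a factor. *)
Lemma nbhs_of_boundary o xi (e : R) : 0 < e ->
  nbhs (of_boundary xi : C)
    [set p | hat_kernel o (inr (boundary_end xi)) (to_hat p) < e].
Proof.
move=> e0; apply: open_nbhs_nbhs; split; last first.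
  by rewrite /= hat_kernel_points moebius_funxx.
set U := [set p | _]; split.
  rewrite openE => r Ur.
  have [d d0 dP] := hat_kernel_space_near o r (half_gap_gt0 Ur).
  apply/nbhs_ballP; exists d; first exact: d0.
  move=> s; rewrite ballEmdist => rs.
  have /ler_distlDr := dP s rs (inr (boundary_end xi)).
  rewrite (hat_kernel_sym o (inl s)) (hat_kernel_sym o (inl r)).
  exact: (lt_of_half_gap Ur).
move=> eta Ueta x.
have [d d0 dP] := hat_kernel_near o (boundary_end eta) (half_gap_gt0 Ueta).
exists (1 - ln (d / expR (3 * mdist o x))) => p /boundary_nbhd_kernel_le H.
have {}H : hat_kernel o (inr (boundary_end eta)) (to_hat p) <= d.
  apply: le_trans (hat_kernel_base o x _ _) _.
  rewrite mulrC -ler_pdivlMr ?expR_gt0//; apply: le_trans H _.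
  by rewrite opprB addrC subrK lnK// posrE divr_gt0 ?expR_gt0.
have /ler_distlDr := dP _ (inr (boundary_end xi)) H.
rewrite (hat_kernel_sym o (to_hat p)).
rewrite (hat_kernel_sym o (inr (boundary_end eta))).
exact: (lt_of_half_gap Ueta).
Qed.

Lemma open_of_boundary o xi (U : set C) : open U -> U (of_boundary xi) ->
  exists2 e, 0 < e & forall p,
    hat_kernel o (inr (boundary_end xi)) (to_hat p) < e -> U p.
Proof.
move=> [_ bU] /bU /(_ o)[r rU]; exists (expR (- r)) => [|p H].
  exact: expR_gt0.
by apply: rU; exact: kernel_lt_boundary_nbhd.
Qed.

Lemma compact_kernel_near o p (e : R) : 0 < e ->
  \forall p' \near p, forall q,
    `|compact_kernel o p' q - compact_kernel o p q| <= e.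
Proof.
move=> e0; case: p => [r|xi].
  have [d d0 dP] := hat_kernel_space_near o r e0.
  apply: filterS (nbhs_of_space r d0) => _ [s -> rs] q; exact: dP.
have [d d0 dP] := hat_kernel_near o (boundary_end xi) e0.
apply: filterS (nbhs_of_boundary o xi d0) => p' H q.
by apply: dP; exact: ltW.
Qed.

(** Near a point of the compactification the kernel is controlled uniformly in
    the other variable, which gives joint continuity. *)
Lemma compact_kernel_continuous o :
  continuous (fun w : C * C => compact_kernel o w.1 w.2).
Proof.
move=> [p q]; apply/cvgrPdist_le => e e0.
have e20 : 0 < e / 2 by rewrite divr_gt0.
exists ([set p' | forall q', `|compact_kernel o p' q' - compact_kernel o p q'|
                    <= e / 2],
        [set q' | forall p', `|compact_kernel o q' p' - compact_kernel o q p'|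
                    <= e / 2]) => /=.
  by split; exact: compact_kernel_near.
move=> [p' q'] /= [/(_ q') H1 /(_ p) H2].
rewrite distrC; apply: le_trans (ler_distD (compact_kernel o p q') _ _) _.
rewrite [e]splitr; apply: lerD => //.
by rewrite /compact_kernel (hat_kernel_sym o (to_hat p))
  [X in _ - X]hat_kernel_sym.
Qed.

(** Infinite where the kernel vanishes, on the diagonal of the boundary. *)
Definition compact_product o p q : \bar R :=
  (- lne (compact_kernel o p q)%:E)%E.

Lemma compact_product_extension o : gromov_extension o (compact_product o).
Proof.
split.
- move=> w; rewrite /continuous_at; apply: cvgeN.
  apply: (@cvg_comp _ _ _ (fun w : C * C => compact_kernel o w.1 w.2)
    (fun u : R => lne u%:E)); last exact: lne_continuous.
  exact: compact_kernel_continuous.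
- by move=> p q; rewrite oppe_ge0 lne_le0 lee_fin hat_kernel_le1.
- move=> r s; rewrite /compact_product /compact_kernel hat_kernel_spaces.
  by rewrite lne_EFin ?expR_gt0// expRK EFinN oppeK.
Qed.

(** Density of the space in its compactification makes the continuous
    extension of the Gromov product unique. *)
Lemma compactification_limit p :
  exists u : R -> M, (of_space (u t) : C) @[t --> +oo] --> p.
Proof.
case: p => [r|xi]; first by exists (fun=> r); exact: cvg_cst.
pose o := moebius_basepoint : M; have [g xig] := visual_boundary_ray xi.
exists g => W; rewrite nbhsE => -[U [oU Uxi] UW].
have [e e0 eU] := open_of_boundary o oU Uxi.
have e20 : 0 < e / 2 by rewrite divr_gt0.
apply: filterS (near_pinfty_ge_expR (mdist o (g 0)) e20) => t [t0 te].
apply: UW; apply: eU.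
apply: le_lt_trans (hat_kernel_ray_end o (boundary_endP xig) t0) _.
by apply: le_lt_trans te _; rewrite ltr_pdivrMr// ltr_pMr// ltr1n.
Qed.

Lemma gromov_extension_unique o G : gromov_extension o G ->
  G = compact_product o.
Proof.
have [ck _ kE] := compact_product_extension o; move=> [cG _ GE].
apply/funext => p; apply/funext => q.
have [u uP] := compactification_limit p.
have [v vP] := compactification_limit q.
have lim (F : C -> C -> \bar R) : continuous (fun w : C * C => F w.1 w.2) ->
    F (of_space (u t)) (of_space (v t)) @[t --> +oo] --> (F p q : \bar R).
  move=> cF; have uv := cvg_pair uP vP.
  exact: (@cvg_comp _ _ _ (fun t => (of_space (u t), of_space (v t)) : C * C)
    (fun w => F w.1 w.2) _ _ _ (uv _ _ _) (cF (p, q))).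
apply: (cvg_unique (@ereal_hausdorff R) (lim _ cG)).
have := lim _ ck; apply: cvg_trans; apply: near_eq_cvg.
by apply: nearW => t; rewrite GE kE.
Qed.

Lemma extended_gromov_productE o :
  extended_gromov_product (X := M) o = compact_product o.
Proof.
apply: gromov_extension_unique.
apply: (@xgetPex _ _ [set G | gromov_extension o G]).
by exists (compact_product o); exact: compact_product_extension.
Qed.

Lemma visual_quasi_metricE o xi eta :
  visual_quasi_metric (X := M) o xi eta
    = o (boundary_end xi) (boundary_end eta).
Proof.
rewrite /visual_quasi_metric extended_gromov_productE /compact_product oppeK.
rewrite lneK; first exact: hat_kernel_points.
by rewrite in_itv/= leey andbT lee_fin hat_kernel_ge0.
Qed.

Lemma boundary_end_homeomorphism : homeomorphism (@boundary_end R Z).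
Proof.
pose o := moebius_basepoint : M; split.
  move=> xi W /(moebius_fun_nbhs o)[d d0 dW].
  have H : nbhs xi ((@of_boundary R M) @^-1` _) :=
    @initial_continuous B C (@of_boundary R M) xi _ (nbhs_of_boundary o xi d0).
  suff : nbhs xi (@boundary_end R Z @^-1` W) by [].
  by apply: filterS H => eta /=; rewrite hat_kernel_points; exact: dW.
pose k z := sval (cid (@boundary_end_surj R Z z)).
have kK z : boundary_end (k z) = z by rewrite /k; case: cid.
exists k; split=> //; first by move=> xi; apply: (boundary_end_inj hyp).
move=> z W; rewrite nbhsE => -[_ [[U oU <-] Uz] UW].
have [e e0 eU] := open_of_boundary o oU Uz.
have cz : \forall y \near z, o z y < e.
  have := @moebius_fun_uniform R Z o z (e / 2).
  rewrite divr_gt0// => /(_ isT); apply: filterS => y /(_ y).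
  rewrite moebius_funxx subr0 ger0_norm ?moebius_fun_ge0//.
  by move=> /le_lt_trans; apply; rewrite ltr_pdivrMr// ltr_pMr// ltr1n.
apply: filterS cz => y zy; apply: UW; apply: eU.
by rewrite /= hat_kernel_points !kK.
Qed.

Lemma boundary_end_moebius o :
  moebius_map (visual_quasi_metric (X := M) o) (@antipodal_fun R Z)
    (@boundary_end R Z).
Proof.
move=> xi xi' eta eta' u; rewrite /cross_ratio !visual_quasi_metricE.
rewrite -/(cross_ratio o _ _ _ _) moebius_fun_equiv//.
by rewrite -(map_inj_uniq (boundary_end_inj hyp)) in u.
Qed.

End compactification.

(** * Quasi-metric antipodal spaces and their fillings *)

Theorem theorem1p2 (R : realType) (Z : antipodalSpace R) :
  (quasi_metric (@antipodal_fun R Z) <->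
     gromov_hyperbolic (moebius_space Z)) /\
  (quasi_metric (@antipodal_fun R Z) ->
   exists f : visual_boundary (moebius_space Z) -> Z,
     moebius_hyperbolic_filling f /\
     forall xi eta : visual_boundary (moebius_space Z),
       antipodal_fun (f xi) (f eta) =
       visual_quasi_metric (moebius_basepoint : moebius_space Z) xi eta).
Proof.
have hyp : quasi_metric (@antipodal_fun R Z) ->
    gromov_hyperbolic (moebius_space Z).
  exact: (@quasi_metric_moebius_hyperbolic R Z moebius_basepoint).
split.
  split=> //; exact: (@moebius_hyperbolic_quasi_metric R Z moebius_basepoint).
move=> /hyp {}hyp; exists (@boundary_end R Z); split; last first.
  by move=> xi eta; rewrite visual_quasi_metricE.
split; [|exact: boundary_end_homeomorphism|exact: boundary_end_moebius].
split=> //; [exact: moebius_space_proper|exact: moebius_space_geodesic|].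
by move=> o; exists (compact_product o); exact: compact_product_extension.
Qed.
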